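(* Let $b\in C_b^1(\mathbb{R})$, $n\ge1$ and $t\in(0,T]$. Then $$\mathbb{E}\Bigl[\Bigl(\int_0^t b'(W_s)\,ds\Bigr)^n\Bigr]=\int_{[0,t]^n}\mathbb{E}\bigl(b(W_{s_1})\cdots b(W_{s_n})\,\Lambda_{s_1\ldots s_n}\bigr)\,ds_1\cdots ds_n,$$ where $\Lambda_{s_1\ldots s_n}$ (defined for almost every $(s_1,\dots,s_n)\in[0,t]^n$, namely for pairwise distinct positive times) is the iterated divergence defined in the context.
   Context: $C_b^1(\mathbb{R})$ is the space of bounded $C^1$ functions with bounded derivative. Fix $T>0$. $\Omega$ is the space of continuous paths $[0,T]\to\mathbb{R}$ with Wiener measure, and $(W_t)_{t\in[0,T]}$ is the canonical one-dimensional standard Brownian motion started at $0$. The Cameron–Martin space is $H=\{h\in\Omega: h(0)=0,\ h \text{ absolutely continuous},\ \int_0^T|\dot h(s)|^2ds<\infty\}$ with $\langle h_1,h_2\rangle_H=\int_0^T\dot h_1\dot h_2\,ds$. $D_hF=\langle\nabla F,h\rangle_H$ is the (Malliavin) derivative of $F$ along $h$, i.e. the derivative at $\varepsilon=0$ of $F(w+\varepsilon h)$, and $\delta$ is the divergence operator, the adjoint of $\nabla$: $\mathbb{E}(\langle\nabla F,Z\rangle_H)=\mathbb{E}(F\,\delta(Z))$. In particular, for deterministic $h\in H$, $\delta(h)=\int_0^T\dot h(s)\,dW_s$, and for a smooth functional $G$, $\delta(Gh)=G\,\delta(h)-D_hG$. For pairwise distinct positive times $s_1,\dots,s_n$, let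 $\sigma_F=(s_i\wedge s_j)_{1\le i,j\le n}$ (the Malliavin covariance matrix of $F=(W_{s_1},\dots,W_{s_n})$), let $\sigma_F^{-1}=(\sigma^{-1}_{ij})_{i,j}$ be its inverse, and for $j=1,\dots,n$ let $h_j\in H$ be $h_j(\tau)=\sum_{i=1}^n\sigma^{-1}_{ij}\,(s_i\wedge\tau)$, $\tau\in[0,T]$. Define $$\Lambda_{s_1\ldots s_n}=\delta\bigl(h_n\,\delta(h_{n-1}\cdots\delta(h_2\,\delta(h_1))\cdots)\bigr),$$ i.e. $\Lambda^{(1)}=\delta(h_1)$, $\Lambda^{(k)}=\delta(h_k\Lambda^{(k-1)})$ for $2\le k\le n$, and $\Lambda_{s_1\ldots s_n}=\Lambda^{(n)}$. *)

(* Defs.v *)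
From HB Require Import structures.
From mathcomp Require Import all_boot all_order all_algebra lra.
From mathcomp Require Import all_classical all_reals all_analysis.

Set Implicit Arguments.
Unset Strict Implicit.
Unset Printing Implicit Defensive.
Import Order.TTheory GRing.Theory Num.Theory.
Import numFieldNormedType.Exports.
Local Open Scope classical_set_scope.
Local Open Scope ring_scope.

Section path_space.
Context (R : realType) (T : R).

Definition clamp (s : R) : R := Num.max 0 (Num.min s T).

Lemma clampK s : clamp (clamp s) = clamp s.
Proof.
by rewrite /clamp /Order.max /Order.min; repeat case: ifPn; rewrite -?leNgt; lra.
Qed.

Lemma clamp_continuous : continuous clamp.
Proof.
move=> x; apply: (@continuous_max _ _ (fun=> 0) (fun s => Num.min s T)).
  exact: cvg_cst.
by apply: (@continuous_min _ _ id (fun=> T)); [exact: cvg_id|exact: cvg_cst].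
Qed.

(* A path of C([0, T]) is represented by its continuous extension to the real
   line that is constant on either side of [0, T]. *)
Definition is_cpath : {pred R -> R^o} :=
  fun w => `[< continuous w /\ forall s, w s = w (clamp s) >].

Lemma is_cpath_submod : submod_closed is_cpath.
Proof.
split; first by apply/asboolP; split => //; exact: (@cst_continuous R R^o 0).
move=> a f g /asboolP[cf ef] /asboolP[cg eg]; apply/asboolP; split.
  move=> x; apply: (@continuousD _ _ _ (fun x => a *: f x) g).
    by apply: (@continuousM _ _ (fun=> a) f); [exact: cst_continuous|exact: cf].
  exact: cg.
have E u : (a *: f + g) u = a * f u + g u by [].
by move=> s; rewrite !E (ef s) (eg s).
Qed.

HB.instance Definition _ := GRing.isSubmodClosed.Build _ _ is_cpath
  is_cpath_submod.

Record cpath := CPath { cpath_fun :> R -> R^o ; _ : cpath_fun \in is_cpath }.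

HB.instance Definition _ := [isSub for cpath_fun].
HB.instance Definition _ := [Choice of cpath by <:].
HB.instance Definition _ := [SubChoice_isSubLmodule of cpath by <:].
HB.instance Definition _ := isPointed.Build cpath 0.

(* Borel cylinder sets; they generate the Borel sigma-algebra of C([0, T]). *)
Definition cylinders : set (set cpath) :=
  [set A | exists s (B : set R), measurable B /\ A = [set w : cpath | B (w s)]].

Let cylinders0 : <<s cylinders >> set0.
Proof. exact: sigma_algebra0. Qed.

Let cylindersC (A : set cpath) : <<s cylinders >> A -> <<s cylinders >> (~` A).
Proof. exact: sigma_algebraC. Qed.

Let cylindersU (F : (set cpath)^nat) : (forall i, <<s cylinders >> (F i)) ->
  <<s cylinders >> (\bigcup_i F i).
Proof. exact: sigma_algebra_bigcup. Qed.

HB.instance Definition _ := @isMeasurable.Build (sigma_display cylinders)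
  cpath <<s cylinders >> cylinders0 cylindersC cylindersU.

Lemma min_clamp_is_cpath (s : R) :
  (fun u => Num.min s (clamp u) : R^o) \in is_cpath.
Proof.
apply/asboolP; split; last by move=> u; rewrite clampK.
move=> x; apply: (@continuous_min _ _ (fun=> s) clamp).
  exact: cvg_cst.
exact: clamp_continuous.
Qed.

(* The Riesz representative in the Cameron-Martin space of w |-> w s. *)
Definition cov_path (s : R) : cpath := CPath (min_clamp_is_cpath s).

End path_space.

Section wiener.
Context (R : realType) (T : R).
Local Open Scope ereal_scope.

Record is_wiener (P : probability (cpath T) R) : Prop := {
  wiener_start : P [set w | w 0%R = 0%R] = 1 ;
  wiener_normal : forall s u : R, (0 <= s)%R -> (s < u)%R -> (u <= T)%R ->
    forall B : set R, measurable B ->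
    P [set w | B (w u - w s)%R] = normal_prob 0%R (Num.sqrt (u - s)%R) B ;
  wiener_indep : forall (m : nat) (tau : nat -> R),
    (0 <= tau 0%N)%R -> (forall i, (i < m)%N -> (tau i <= tau i.+1)%R) ->
    (tau m <= T)%R ->
    forall B : nat -> set R, (forall i, measurable (B i)) ->
    P [set w | forall i, (i < m)%N -> B i (w (tau i.+1) - w (tau i))%R] =
    \prod_(i < m) P [set w | B i (w (tau i.+1) - w (tau i))%R] }.

End wiener.

Section cameron_martin.
Context (R : realType).

Definition abs_continuous (a b : R) (f : R -> R) : Prop :=
  forall e : R, 0 < e -> exists2 d : R, 0 < d &
  forall (m : nat) (u v : nat -> R),
    (forall i, (i < m)%N -> [/\ a <= u i, u i <= v i & v i <= b]) ->
    (forall i, (i.+1 < m)%N -> v i <= u i.+1) ->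
    \sum_(i < m) (v i - u i) < d ->
    \sum_(i < m) `|f (v i) - f (u i)| < e.

Definition cm_norm2 (T : R) (h : cpath T) : \bar R :=
  (\int[lebesgue_measure]_(s in `[0%R, T]) ((derive1 h s) ^+ 2)%R%:E)%E.

Definition cameron_martin (T : R) : set (cpath T) :=
  [set h : cpath T | [/\ h 0 = 0, abs_continuous 0 T h & (cm_norm2 h < +oo)%E]].

End cameron_martin.

Section malliavin.
Context (R : realType).

Definition C1b (b : R -> R) : Prop :=
  [/\ forall x, derivable b x 1, continuous (derive1 b),
      exists M, forall x, `|b x| <= M &
      exists M, forall x, `|derive1 b x| <= M].

Definition C1b_rV (m : nat) (f : 'rV[R]_m -> R) : Prop :=
  [/\ forall x, differentiable f x,
      forall v, continuous (fun x => 'D_v f x),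
      exists M, forall x, `|f x| <= M &
      forall v, exists M, forall x, `|'D_v f x| <= M].

Context (T : R).

(* D_h F(w), which is <nabla F(w), h>_H for h in the Cameron-Martin space. *)
Definition dir_deriv (F : cpath T -> R) (h w : cpath T) : R :=
  derive1 (fun e : R => F (w + e *: h)) 0.

Definition smooth_cylindrical (F : cpath T -> R) : Prop :=
  exists (m : nat) (tau : 'I_m -> R) (f : 'rV[R]_m -> R),
    [/\ forall i, 0 <= tau i <= T, C1b_rV f &
        forall w, F w = f (\row_i w (tau i))].

Variable P : probability (cpath T) R.

(* Z belongs to L^2(P; H). *)
Definition square_integrable_field (Z : cpath T -> cpath T) : Prop :=
  [/\ forall w, cameron_martin (Z w),
      forall s : R, measurable_fun setT (fun w => Z w s : R) &
      (\int[P]_w cm_norm2 (Z w) < +oo)%E].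

(* The smooth cylindrical functionals form a core of nabla, so that duality
   against them characterizes the adjoint of nabla. *)
Definition is_divergence (Z : cpath T -> cpath T) (D : cpath T -> R) : Prop :=
  [/\ square_integrable_field Z, measurable_fun setT D,
      (\int[P]_w ((D w) ^+ 2)%R%:E < +oo)%E &
      forall F, smooth_cylindrical F ->
        'E_P[fun w => dir_deriv F (Z w) w] = 'E_P[fun w => (F w * D w)%R]]%E.

(* A version of delta(Z), unique up to P-null sets; 0 outside the domain. *)
Definition divergence (Z : cpath T -> cpath T) : cpath T -> R :=
  xget (fun=> 0) [set D | is_divergence Z D].

Definition malliavin_cov (n : nat) (s : n.-tuple R) : 'M[R]_n :=
  \matrix_(i, j) Num.min (tnth s i) (tnth s j).

Definition dual_path (n : nat) (s : n.-tuple R) (j : 'I_n) : cpath T :=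
  \sum_(i < n) invmx (malliavin_cov s) i j *: cov_path T (tnth s i).

(* Lambda^(k) = delta(h_k Lambda^(k-1)) started from Lambda^(0) = 1. *)
Definition iter_divergence (n : nat) (s : n.-tuple R) : cpath T -> R :=
  foldl (fun G j => divergence (fun w => G w *: dual_path s j))
        (fun=> 1) (enum 'I_n).

(* Lambda_(s_1 ... s_n), set to 0 on the null set of exceptional times. *)
Definition Lambda (n : nat) (s : n.-tuple R) : cpath T -> R :=
  if uniq s && all (fun x => 0 < x) s then iter_divergence s else fun=> 0.

End malliavin.

Section lebesgue_tuple.
Context (R : realType).
Let Rm : measurableType _ := measurableTypeR R.

Definition tcons (n : nat) (x : Rm * n.-tuple Rm) : n.+1.-tuple Rm :=
  [tuple of x.1 :: x.2].

Lemma measurable_tcons n : measurable_fun setT (@tcons n).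
Proof. exact: measurable_cons. Qed.

HB.instance Definition _ n := isMeasurableFun.Build _ _ _ _ (@tcons n)
  (@measurable_tcons n).

Section step.
Context (n : nat) (mu : {sigma_finite_measure set (n.-tuple Rm) -> \bar R}).

Definition lebesgue_cons : set (n.+1.-tuple Rm) -> \bar R :=
  pushforward ((@lebesgue_measure R) \x mu)%E (@tcons n).

Let lebesgue_cons0 : lebesgue_cons set0 = 0%E.
Proof. by rewrite /lebesgue_cons /pushforward preimage_set0 measure0. Qed.

Let lebesgue_cons_ge0 A : (0 <= lebesgue_cons A)%E.
Proof. exact: measure_ge0. Qed.

Let lebesgue_cons_additive : semi_sigma_additive lebesgue_cons.
Proof.
have mpre (A : set (n.+1.-tuple Rm)) :
    measurable A -> measurable (@tcons n @^-1` A).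
  by move=> mA; rewrite -[X in measurable X]setTI; exact: measurable_tcons.
move=> F mF tF mUF; rewrite /lebesgue_cons /pushforward preimage_bigcup.
apply: measure_semi_sigma_additive.
- by move=> i; exact: mpre.
- apply/trivIsetP => /= i j _ _ ij; rewrite -preimage_setI.
  by move/trivIsetP : tF => /(_ _ _ _ _ ij) ->//; rewrite preimage_set0.
- by rewrite -preimage_bigcup; exact: mpre.
Qed.

HB.instance Definition _ := isMeasure.Build _ _ _ lebesgue_cons
  lebesgue_cons0 lebesgue_cons_ge0 lebesgue_cons_additive.

Let lebesgue_cons_sigma_finite : sigma_finite setT lebesgue_cons.
Proof.
have /sigma_finiteP[F [TF ndF Foo]] :=
  sigma_finiteT (@lebesgue_measure R : {sigma_finite_measure set Rm -> \bar R}).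
have /sigma_finiteP[G [TG ndG Goo]] := sigma_finiteT mu.
pose g (s : n.+1.-tuple Rm) : Rm * n.-tuple Rm := (thead s, [tuple of behead s]).
have gK x : g (tcons x) = x by case: x => a s; congr (_, _); exact/val_inj.
have mg : measurable_fun setT g.
  by apply/measurable_fun_pairP; split;
    [exact: measurable_tnth|exact: measurable_behead].
exists (fun k => g @^-1` (F k `*` G k)).
  rewrite -preimage_bigcup -(@preimage_setT _ _ g); congr (g @^-1` _).
  rewrite -setXTT TF TG predeqE => -[x y]; split; last first.
    by move=> [k _ []/= ? ?]; split; exists k.
  move=> [/= [i _ Fix] [k _ Gky]]; exists (maxn i k) => //; split.
  - by move: x Fix; exact/subsetPset/ndF/leq_maxl.
  - by move: y Gky; exact/subsetPset/ndG/leq_maxr.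
move=> k; have [mF ?] := Foo k; have [mG ?] := Goo k; split.
  by rewrite -[X in measurable X]setTI; apply: mg => //; exact: measurableX.
rewrite /lebesgue_cons /pushforward (_ : _ @^-1` _ = F k `*` G k).
  by rewrite product_measure1E// lte_mul_pinfty// ge0_fin_numE.
by rewrite -comp_preimage (_ : g \o _ = id)//; exact/funext.
Qed.

HB.instance Definition _ := Measure_isSigmaFinite.Build _ _ _ lebesgue_cons
  lebesgue_cons_sigma_finite.

End step.

(* Lebesgue measure on R^n. *)
Fixpoint lebesgue_tuple (n : nat) :
    {sigma_finite_measure set (n.-tuple Rm) -> \bar R} :=
  match n with
  | 0 => dirac [tuple]
  | m.+1 => lebesgue_cons (lebesgue_tuple m)
  end.

End lebesgue_tuple.

(* Main.v *)
Require Import Defs.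
From HB Require Import structures.
From mathcomp Require Import all_boot all_order all_algebra ring lra.
From mathcomp Require Import all_classical all_reals all_analysis.
From mathcomp Require Import measurable_realfun.
Set Implicit Arguments.
Unset Strict Implicit.
Unset Printing Implicit Defensive.
Import Order.TTheory GRing.Theory Num.Theory.
Import numFieldNormedType.Exports.
Local Open Scope classical_set_scope.
Local Open Scope ring_scope.

(** The formula comes from n integrations by parts on Wiener space, one for each
    factor b'(W_(s_i)).

    By Fubini, the moment on the left is the integral over [0, t]^n of
    E(b'(W_(s_1)) ... b'(W_(s_n))) ([moment_fubini]). The times that are not
    pairwise distinct and positive form a null set ([bad_times_null]), so it
    remains to prove, for the other ones,
      E(b'(W_(s_1)) ... b'(W_(s_n))) = E(b(W_(s_1)) ... b(W_(s_n)) Lambda),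
    which is [expectation_weight].

    The covariance matrix of the W_(s_i) is then invertible
    ([malliavin_cov_unitmx]), and the paths h_j are dual to the evaluations:
    h_j(s_k) is 1 if k = j and 0 otherwise ([dual_path_ev]). Hence moving a path
    along h_j moves its value at s_j alone, and D_(h_j) replaces the factor
    b(W_(s_j)) of a product by b'(W_(s_j)) without touching the other factors
    ([tame_mixed_prod]). Duality, E(D_(h_j) F Q) = E(F delta(Q h_j)), removes
    the derivatives one at a time, and the weight Q, which is 1 at the start,
    takes up one divergence at each step ([integral_weight_poly]).

    Duality rests on the Cameron-Martin formula: the law of the increments of a
    Brownian motion on a grid is a product of centred normal laws, whose
    translates have an explicit density ([gauss_shift]); this gives the formula
    for cylinder sets ([cameron_martin_rays]), and a pi-lambda argument extends
    it to all functionals ([shift_formula_cov]). Differentiating it at 0 gives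
    integration by parts ([wiener_integration_by_parts]), and the product rule
    gives duality, with delta(Q h) = Q delta(h) - D_h Q ([duality_poly]).

    The operator [divergence] picks an arbitrary random variable among those
    that satisfy the duality relation. Such a variable exists for the fields at
    hand ([is_divergence_poly_div]) and is unique almost surely
    ([divergence_unique]), so that Lambda is almost surely the polynomial in
    path values given by the formula for delta(Q h) ([iter_divergence_poly]). *)

(** * Integrals against a density *)

Section density.
Context d (T : measurableType d) (R : realType).
Variables (mu nu : {measure set T -> \bar R}) (p : T -> R).
Hypothesis p0 : forall x, 0 <= p x.
Hypothesis mp : measurable_fun setT p.
Hypothesis nuE : forall A, measurable A ->
  (nu A = \int[mu]_(x in A) (p x)%:E)%E.
Import HBNNSimple.

(** By definition for indicators, then by linearity for simple functions, and by
    monotone convergence in general. *)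
Lemma ge0_integral_density (f : T -> \bar R) :
  measurable_fun setT f -> (forall x, 0 <= f x)%E ->
  (\int[nu]_x f x = \int[mu]_x (f x * (p x)%:E))%E.
Proof.
move=> mf f0; pose h := nnsfun_approx measurableT mf.
have hf x : EFin (h n x) @[n --> \oo] --> f x.
  exact: (@cvg_nnsfun_approx _ _ _ _ measurableT f mf (fun x _ => f0 x) x I).
have fE x : f x = limn (fun n => (h n x)%:E) by apply/esym/cvg_lim.
have step (g : {nnsfun T >-> R}) :
    (\int[nu]_x (g x)%:E = \int[mu]_x ((g x)%:E * (p x)%:E))%E.
  under [LHS]eq_integral do rewrite fimfunE -fsumEFin//.
  rewrite [LHS]ge0_integral_fsum//; last 2 first.
    - by move=> r; exact/measurable_EFinP/measurableT_comp.
    - by move=> n x _; rewrite EFinM nnfun_muleindic_ge0.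
  under [RHS]eq_integral.
    move=> x xD; rewrite fimfunE -fsumEFin// muleC ge0_mule_fsumr; last first.
      by move=> r; rewrite EFinM nnfun_muleindic_ge0.
    over.
  rewrite [RHS]ge0_integral_fsum//; last 2 first.
    - move=> r; apply: emeasurable_funM; first exact/measurable_EFinP.
      exact/measurable_EFinP/measurableT_comp.
    - move=> n x _; rewrite EFinM mule_ge0//; first by rewrite lee_fin.
      by rewrite nnfun_muleindic_ge0.
  apply: eq_fsbigr => r _.
  rewrite integralZl_indic_nnsfun// integral_indic//= setIT nuE//.
  have [r0|r0] := leP 0 r; last first.
    rewrite preimage_nnfun0// integral_set0 mule0 integral0_eq// => x _.
    by rewrite indic0 mulr0 mule0.
  rewrite [X in (_ * X)%E]integral_mkcond -ge0_integralZl_EFin//; last 2 first.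
    by move=> x _; rewrite patchE; case: ifP; rewrite ?lee_fin.
    apply: (measurable_restrictT _ _).1 => //; apply: measurable_funTS.
    exact/measurable_EFinP.
  apply: eq_integral => x _; rewrite patchE indicE.
  case: ifPn => _ /=; first by rewrite mulr1 muleC.
  by rewrite mulr0 !mule0.
under eq_integral do rewrite fE.
rewrite monotone_convergence//; last 3 first.
- by move=> n; exact/measurable_EFinP.
- by move=> n x _; rewrite lee_fin.
- by move=> x _ a b ab; rewrite lee_fin; exact/lefP/nd_nnsfun_approx.
under eq_fun do rewrite step.
rewrite -monotone_convergence//; last 3 first.
- move=> n; apply: emeasurable_funM; exact/measurable_EFinP.
- by move=> n x _; rewrite mule_ge0// lee_fin.
- move=> x _ a b ab; apply: lee_wpmul2r; first by rewrite lee_fin.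
  by rewrite lee_fin; exact/lefP/nd_nnsfun_approx.
apply: eq_integral => x _; apply/cvg_lim => //.
exact: cvgeZr (hf x).
Qed.
End density.

(** * Translations of Gaussian measures *)
Section gauss.
Context (R : realType).
Let Rm : measurableType _ := measurableTypeR R.

Lemma ge0_integral_lebesgue_shift (c : R) (f : Rm -> \bar R) :
  measurable_fun setT f -> (forall x, 0 <= f x)%E ->
  (\int[lebesgue_measure]_x f (x + c)%R = \int[lebesgue_measure]_x f x)%E.
Proof.
move=> mf f0.
have mc : measurable_fun setT (fun x : Rm => x + c : Rm).
  exact: measurable_funD.
pose phi : {mfun Rm >-> Rm} := HB.pack (fun x : Rm => x + c : Rm)
  (isMeasurableFun.Build _ _ _ _ _ mc).
rewrite -[LHS](ge0_integral_pushforward mc lebesgue_measure measurableT)//.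
apply: eq_measure_integral => A mA _; apply/esym.
apply: (@lebesgue_measure_unique _ (pushforward lebesgue_measure phi)) => //.
move=> X [[a b]] /= ab <-; rewrite /pushforward.
rewrite (_ : phi @^-1` _ = `]a - c, b - c]%classic); last first.
  by apply/seteqP; split => x /=; rewrite !in_itv/= /= ltrBlDr lerBrDr.
rewrite !lebesgue_measure_itv/= !lte_fin ltrD2r.
by case: ifPn => // _; rewrite !EFinN -!EFinB opprB addrA subrK.
Qed.

(** Translation invariance of Lebesgue measure moves the shift to the normal
    density; completing the square then compares the density at x - a v with the
    density at x. *)
Lemma gauss_shift1 (v a : R) (f : Rm -> \bar R) : 0 < v ->
  measurable_fun setT f -> (forall x, 0 <= f x)%E ->
  (\int[normal_prob 0 (Num.sqrt v)]_x f (x + a * v)%R =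
   \int[normal_prob 0 (Num.sqrt v)]_x
     (f x * (expR (a * x - a ^+ 2 * v / 2))%:E))%E.
Proof.
move=> v0 mf f0.
have s0 : Num.sqrt v != 0 by rewrite gt_eqF// sqrtr_gt0.
have mp := measurable_normal_pdf (0 : R) (Num.sqrt v).
have p0 := @normal_pdf_ge0 R 0 (Num.sqrt v).
have mfs : measurable_fun setT (fun x : Rm => f (x + a * v)).
  by apply: measurableT_comp => //; exact: measurable_funD.
have me : measurable_fun setT (fun x : Rm => expR (a * x - a ^+ 2 * v / 2)).
  apply: measurableT_comp => //; apply: measurable_funB; last exact: measurable_cst.
  by apply: measurable_funM.
pose mu : {measure set Rm -> \bar R} := lebesgue_measure.
pose nu : {measure set Rm -> \bar R} := normal_prob 0 (Num.sqrt v).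
have D := @ge0_integral_density _ _ R mu nu _ p0 mp (fun _ _ => erefl).
rewrite [LHS]D// [RHS]D//; last 2 first.
- by apply: emeasurable_funM => //; exact/measurable_EFinP.
- by move=> x; rewrite mule_ge0// lee_fin expR_ge0.
pose g (x : R) := (f x * (normal_pdf 0 (Num.sqrt v) (x - a * v))%:E)%E.
transitivity (\int[mu]_x g (x + a * v)%R)%E.
  by apply: eq_integral => x _; rewrite /g addrK.
rewrite /mu ge0_integral_lebesgue_shift; last 2 first.
- apply: emeasurable_funM => //; apply/measurable_EFinP.
  by apply: (measurableT_comp mp); exact: measurable_funB.
- by move=> x; rewrite mule_ge0// lee_fin.
apply: eq_integral => x _; rewrite /g -muleA -EFinM; congr (_ * _%:E)%E.
rewrite !normal_pdfE//= mulrCA; congr (_ * _).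
rewrite /normal_fun -expRD; congr expR.
rewrite sqr_sqrtr ?ltW// -mulr_natr; field.
by rewrite gt_eqF.
Qed.

(** The product of the centred normal laws of variances v 0, ..., v (n - 1); the
    recursion follows that of [lebesgue_tuple], so that Tonelli's theorem peels
    off the first coordinate in both cases. *)
Fixpoint gauss_tuple (v : nat -> R) n : probability (n.-tuple Rm) R :=
  match n with
  | O => dirac [tuple]
  | S m => distribution (normal_prob 0 (Num.sqrt (v 0%N)) \x
       gauss_tuple (fun i => v i.+1) m)%E (@tcons R m)
  end.

Lemma ge0_integral_tcons (m1 : {sigma_finite_measure set Rm -> \bar R}) n
    (m2 : {sigma_finite_measure set (n.-tuple Rm) -> \bar R})
    (f : n.+1.-tuple Rm -> \bar R) :
  measurable_fun setT f -> (forall x, 0 <= f x)%E ->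
  (\int[pushforward (m1 \x m2)%E (@tcons R n)]_x f x =
   \int[m1]_x \int[m2]_y f (tcons (x, y)))%E.
Proof.
move=> mf f0; rewrite ge0_integral_pushforward//.
rewrite fubini_tonelli1//.
  by apply: (measurableT_comp mf); exact: measurable_tcons.
by move=> x; exact: f0.
Qed.

Definition shift_tuple n (c : nat -> R) (x : n.-tuple Rm) : n.-tuple Rm :=
  [tuple tnth x i + c i | i < n].

Lemma measurable_shift_tuple n c : measurable_fun setT (@shift_tuple n c).
Proof.
apply/measurable_fun_tnthP => i.
rewrite (_ : _ \o _ = fun x : n.-tuple Rm => tnth x i + c i).
  by apply: measurable_funD => //; exact: measurable_tnth.
by apply/funext => x /=; rewrite tnth_mktuple.
Qed.

Lemma shift_tcons n c x (y : n.-tuple Rm) :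
  shift_tuple c (tcons (x, y)) =
  tcons (x + c 0, shift_tuple (fun i => c i.+1) y) :> (n.+1.-tuple Rm).
Proof.
apply: eq_from_tnth => i; rewrite tnth_mktuple.
case: (unliftP ord0 i) => [j|] ->; last by rewrite !tnth0.
by rewrite !tnthS tnth_mktuple.
Qed.

Lemma measurable_tnth_sum n (a c : nat -> R) : measurable_fun setT
  (fun x : n.-tuple Rm => \sum_(i < n) (a i * tnth x i - c i)).
Proof.
apply: measurable_sum => i; apply: measurable_funB => //.
by apply: measurable_funM => //; exact: measurable_tnth.
Qed.

(** Coordinate by coordinate, from [gauss_shift1] and Tonelli's theorem. Shifts
    are written as multiples of the variances because this makes the exponent a
    polynomial in the variances, and nonnegative functions spare all
    integrability conditions. *)
Lemma gauss_shift n (v a : nat -> R) (f : n.-tuple Rm -> \bar R) :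
  (forall i, (i < n)%N -> 0 < v i) ->
  measurable_fun setT f -> (forall x, 0 <= f x)%E ->
  (\int[gauss_tuple v n]_x f (shift_tuple (fun i => a i * v i)%R x) =
   \int[gauss_tuple v n]_x
    (f x * (expR (\sum_(i < n) (a i * tnth x i - a i ^+ 2 * v i / 2))%R)%:E))%E.
Proof.
have mg k (u b : nat -> R) (g : k.-tuple Rm -> \bar R) : measurable_fun setT g ->
    measurable_fun setT (fun x : k.-tuple Rm => (g x *
      (expR (\sum_(i < k) (b i * tnth x i - b i ^+ 2 * u i / 2))%R)%:E)%E).
  move=> mg; apply: emeasurable_funM => //; apply/measurable_EFinP.
  apply: measurableT_comp => //.
  exact: (measurable_tnth_sum b (fun i => b i ^+ 2 * u i / 2)).
have ms k c (g : k.-tuple Rm -> \bar R) : measurable_fun setT g ->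
    measurable_fun setT (fun x : k.-tuple Rm => g (shift_tuple c x)).
  by move=> mgg; apply: (measurableT_comp mgg); exact: measurable_shift_tuple.
elim: n v a f => [|n IH] v a f v0 mf f0.
  rewrite /= !integral_dirac//; [|exact: mg|exact: ms].
  rewrite diracE in_setT !mul1e big_ord0 expR0 mule1.
  by congr f; rewrite tuple0.
rewrite /= !ge0_integral_tcons//; last 3 first.
- exact: mg.
- by move=> x; rewrite mule_ge0// lee_fin expR_ge0.
- exact: ms.
pose e y := (expR (\sum_(i < n)
  (a i.+1 * tnth y i - a i.+1 ^+ 2 * v i.+1 / 2))%R)%:E : \bar R.
pose F (x : Rm) := (\int[gauss_tuple (fun i => v i.+1) n]_y
  (f (tcons (x, y)) * e y))%E.
have mft : measurable_fun setT (f \o @tcons R n).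
  by apply: (measurableT_comp mf); exact: measurable_tcons.
have mfc x : measurable_fun setT (fun y : n.-tuple Rm => f (tcons (x, y))).
  exact: (measurableT_comp mft (pair1_measurable x)).
transitivity (\int[normal_prob 0 (Num.sqrt (v 0%N))]_x
   F (x + a 0%N * v 0%N)%R)%E.
  apply: eq_integral => x _.
  have v0' i : (i < n)%N -> 0 < v i.+1 by rewrite -ltnS => /v0.
  have := IH (fun i => v i.+1) (fun i => a i.+1)
    (fun y => f (tcons (x + a 0%N * v 0%N, y))) v0' (mfc _) (fun y => f0 _).
  rewrite -/(F _) => <-.
  by apply: eq_integral => y _; rewrite shift_tcons.
have e0 y : (0 <= e y)%E by rewrite lee_fin expR_ge0.
rewrite gauss_shift1 ?v0//; last 2 first.
- apply: (@measurable_fun_fubini_tonelli_F _ _ _ _ R _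
    (fun xy => f (tcons xy) * e xy.2)%E) => //.
  + apply: emeasurable_funM => //; apply/measurable_EFinP.
    apply: measurableT_comp => //.
    exact: (measurableT_comp (@measurable_tnth_sum n (fun i => a i.+1)
      (fun i => a i.+1 ^+ 2 * v i.+1 / 2)) measurable_snd).
  + by move=> x; rewrite mule_ge0.
- by move=> x; apply: integral_ge0 => y _; rewrite mule_ge0.
apply: eq_integral => x _; rewrite /F -ge0_integralZr//; last 2 first.
- by apply: (mg n (fun i => v i.+1) (fun i => a i.+1) (fun y => f (tcons (x, y)))).
- by move=> y _; rewrite mule_ge0.
apply: eq_integral => y _; rewrite -muleA -EFinM -expRD; congr (_ * (expR _)%:E)%E.
rewrite big_ord_recl addrC; congr (_ + _).
by apply: eq_bigr => i _; rewrite /tcons tnthS.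
Qed.

(** Independence prescribes the law of the increments on these sets only; as a
    generating pi-system they determine it. *)
Definition boxes n : set (set (n.-tuple Rm)) :=
  [set A | exists B : nat -> set Rm, (forall i, measurable (B i)) /\
     A = [set x | forall i : 'I_n, B i (tnth x i)]].

Lemma boxes_setI n : setI_closed (@boxes n).
Proof.
move=> _ _ [B [mB ->]] [C [mC ->]]; exists (fun i => B i `&` C i).
split; first by move=> i; exact: measurableI.
apply/seteqP; split=> x /= => [[xB xC] i|xBC]; first by split.
by split=> i; case: (xBC i).
Qed.

Lemma boxes_measurable n : @boxes n `<=` measurable.
Proof.
move=> _ [B [mB ->]].
rewrite (_ : [set _ | _] =
    \bigcap_(i in [set: 'I_n]) ((fun x : n.-tuple Rm => tnth x i) @^-1` B i)).
  apply: fin_bigcap_measurable => // i _; rewrite -[X in measurable X]setTI.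
  exact: measurable_tnth.
by apply/seteqP; split => x /= xB i; [move=> _|]; exact: xB.
Qed.

Lemma boxes_generate n : @measurable _ (n.-tuple Rm) = <<s @boxes n >>.
Proof.
apply/seteqP; split.
  apply: smallest_sub; first exact: smallest_sigma_algebra.
  move=> X; rewrite -bigcup_seq /= => -[i _ [A mA <-]].
  apply: sub_sigma_algebra.
  exists (fun j => if j == i :> nat then A else setT); split.
    by move=> j; case: ifP.
  apply/seteqP; split => x /=.
    by move=> [_ xA] j; case: ifPn => // /eqP/val_inj ->.
  by move=> /(_ i); rewrite eqxx => xA; split.
apply: smallest_sub; first exact: sigma_algebra_measurable.
exact: boxes_measurable.
Qed.

Lemma gauss_rect n (v : nat -> R) (B : nat -> set Rm) :
  (forall i, measurable (B i)) ->
  (gauss_tuple v n [set x | forall i : 'I_n, B i (tnth x i)] =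
   \prod_(i < n) normal_prob 0 (Num.sqrt (v i)) (B i))%E.
Proof.
elim: n v B => [|n IH] v B mB.
  rewrite big_ord0 /= (_ : [set _ | _] = setT) ?diracT//.
  by apply/seteqP; split => // x _ [].
rewrite big_ord_recl /= /distribution /pushforward.
rewrite (_ : _ @^-1` _ = B 0%N `*`
    [set x : n.-tuple Rm | forall i : 'I_n, B i.+1 (tnth x i)]); last first.
  apply/seteqP; split => [[x y] /= xyB|[x y] /= [xB yB] i].
    split; first by have := xyB ord0; rewrite /tcons tnth0.
    by move=> i; have := xyB (lift ord0 i); rewrite /tcons tnthS.
  case: (unliftP ord0 i) => [j|] ->; rewrite /tcons ?tnth0// tnthS.
  exact: yB.
rewrite product_measure1E//.
  by congr (_ * _)%E; exact: (IH (fun i => v i.+1) (fun i => B i.+1)).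
by apply: boxes_measurable; exists (fun i => B i.+1).
Qed.

End gauss.

(** * Measurable sets of paths *)
Section pi_lambda.
Context d d1 d2 (T : measurableType d) (T1 : measurableType d1)
  (T2 : measurableType d2) (R : realType).
Variables (m1 : {measure set T1 -> \bar R}) (m2 : {measure set T2 -> \bar R}).
Variables (phi1 : T1 -> T) (phi2 : T2 -> T).
Hypotheses (mphi1 : measurable_fun setT phi1) (mphi2 : measurable_fun setT phi2).
Variables (f1 : T1 -> \bar R) (f2 : T2 -> \bar R).
Hypotheses (if1 : m1.-integrable setT f1) (if2 : m2.-integrable setT f2).
Local Open Scope ereal_scope.

(** The sets on which the two integrals agree form a Dynkin system: a complement
    is treated by subtraction from the total integrals, which are finite by
    integrability, and a disjoint union by countable additivity. With a map on
    either side the statement compares a law with an image law, and with two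
    identities it compares two densities. *)
Lemma pi_lambda_integral (G : set (set T)) :
  @measurable _ T = <<s G >> -> setI_closed G ->
  \int[m1]_x f1 x = \int[m2]_x f2 x ->
  (forall A, G A ->
    \int[m1]_(x in phi1 @^-1` A) f1 x = \int[m2]_(x in phi2 @^-1` A) f2 x) ->
  forall A, measurable A ->
    \int[m1]_(x in phi1 @^-1` A) f1 x = \int[m2]_(x in phi2 @^-1` A) f2 x.
Proof.
move=> GE GI eqT eqG A mA.
have m1S S : measurable S -> measurable (phi1 @^-1` S).
  by move=> mS; rewrite -[X in measurable X]setTI; exact: mphi1.
have m2S S : measurable S -> measurable (phi2 @^-1` S).
  by move=> mS; rewrite -[X in measurable X]setTI; exact: mphi2.
have i1 S : measurable S -> m1.-integrable (phi1 @^-1` S) f1.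
  by move=> mS; apply: (integrableS measurableT) => //; exact: m1S.
have i2 S : measurable S -> m2.-integrable (phi2 @^-1` S) f2.
  by move=> mS; apply: (integrableS measurableT) => //; exact: m2S.
pose Q S := \int[m1]_(x in phi1 @^-1` S) f1 x = \int[m2]_(x in phi2 @^-1` S) f2 x.
have sA : <<s G >> A by rewrite -GE.
apply: (@dynkin_induction _ T G Q GE GI _ eqG _ _ _ sA); first exact: eqT.
- move=> S mS; rewrite /Q => eqS; rewrite -2!preimage_setC.
  have c1 : \int[m1]_x f1 x =
      \int[m1]_(x in ~` (phi1 @^-1` S)) f1 x + \int[m1]_(x in phi1 @^-1` S) f1 x.
    rewrite -integral_setU ?setvU//.
    - by apply: measurableC; exact: m1S.
    - exact: m1S.
    - exact: (measurable_int _ if1).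
    - by rewrite disj_set_sym; apply/disj_setPS; rewrite setICr.
  have c2 : \int[m2]_x f2 x =
      \int[m2]_(x in ~` (phi2 @^-1` S)) f2 x + \int[m2]_(x in phi2 @^-1` S) f2 x.
    rewrite -integral_setU ?setvU//.
    - by apply: measurableC; exact: m2S.
    - exact: m2S.
    - exact: (measurable_int _ if2).
    - by rewrite disj_set_sym; apply/disj_setPS; rewrite setICr.
  have fin1 := integrable_fin_num (m1S _ mS) (i1 _ mS).
  have fin2 := integrable_fin_num (m2S _ mS) (i2 _ mS).
  by rewrite -[LHS](addeK _ fin1) -c1 eqT c2 eqS addeK.
- move=> F mF tF eqF; rewrite /Q 2!preimage_bigcup.
  rewrite !integral_bigcup//.
  + apply: eq_eseriesr => k _; exact: eqF.
  + apply/trivIsetP => i j _ _ ij; rewrite -preimage_setI.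
    by move/trivIsetP : tF => /(_ _ _ I I ij) ->; rewrite preimage_set0.
  + by move=> k; exact: m2S.
  + by rewrite -preimage_bigcup; apply: i2; exact: bigcup_measurable.
  + apply/trivIsetP => i j _ _ ij; rewrite -preimage_setI.
    by move/trivIsetP : tF => /(_ _ _ I I ij) ->; rewrite preimage_set0.
  + by move=> k; exact: m1S.
  + by rewrite -preimage_bigcup; apply: i1; exact: bigcup_measurable.
Qed.
End pi_lambda.

Section paths.
Context (R : realType) (T : R).
Local Notation cpath := (cpath T).

Lemma cpath_generate : @measurable _ cpath = <<s @cylinders R T >>.
Proof. by []. Qed.

Lemma measurable_ev (s : R) : measurable_fun setT (fun w : cpath => w s : R).
Proof.
move=> _ B mB; rewrite setTI; apply: sub_sigma_algebra; exists s, B; split => //.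
Qed.

Lemma measurable_to_cpath d (X : measurableType d) (f : X -> cpath) :
  (forall s, measurable_fun setT (fun x => f x s : R)) -> measurable_fun setT f.
Proof.
move=> mf; apply: (measurability _ cpath_generate) => _ [_ [s [B [mB ->]]] <-].
exact: (mf s measurableT _ mB).
Qed.

Lemma clampE s : 0 <= s <= T -> clamp T s = s.
Proof.
by move=> /andP[s0 sT]; rewrite /clamp min_l// max_r.
Qed.

Lemma clamp_bounds s : 0 < T -> 0 <= clamp T s <= T.
Proof.
by move=> /ltW T0; rewrite /clamp le_max lexx/= ge_max T0 ge_min lexx orbT.
Qed.

Lemma cpath_clamp (w : cpath) s : w s = w (clamp T s).
Proof. by case: w => f /= /asboolP[_]; exact. Qed.

Lemma cpath_continuous (w : cpath) : continuous (w : R -> R^o).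
Proof. by case: w => f /= /asboolP[]. Qed.

Lemma cpathD (w h : cpath) s : (w + h) s = w s + h s :> R.
Proof. by []. Qed.

Lemma cpathZ c (h : cpath) s : (c *: h) s = c * h s :> R.
Proof. by []. Qed.

Lemma cpath_sum I (r : seq I) (h : I -> cpath) s :
  (\sum_(i <- r) h i) s = \sum_(i <- r) h i s :> R.
Proof.
by elim: r => [|i r IH]; rewrite ?big_nil// !big_cons cpathD IH.
Qed.

Lemma cov_pathE s u : 0 <= u <= T -> cov_path T s u = Num.min s u :> R.
Proof. by move=> uT; rewrite /= clampE. Qed.

Lemma measurable_translate (h : cpath) : measurable_fun setT (fun w : cpath => w + h).
Proof.
apply: measurable_to_cpath => s; apply: measurable_funD => //.
exact: measurable_ev.
Qed.

(** Lists of constraints, so that intersections are concatenations. Strict upper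
    bounds suffice to generate the sigma-algebra, and their indicators are limits
    of smooth functions. *)
Definition rays (l : seq (R * R)) : set cpath :=
  [set w | all (fun p => w p.1 < p.2) l].

Definition ray_cylinders : set (set cpath) := range rays.

Lemma ray_cylinders_setI : setI_closed ray_cylinders.
Proof.
move=> _ _ [l _ <-] [l' _ <-]; exists (l ++ l') => //.
by apply/seteqP; split=> w; rewrite /rays /= all_cat => /andP.
Qed.

Lemma measurable_rays l : measurable (rays l).
Proof.
elim: l => [|[s a] l IH].
  by rewrite (_ : rays _ = setT)//; apply/seteqP; split.
rewrite (_ : rays _ = (fun w : cpath => w s : R) @^-1` `]-oo, a[ `&` rays l).
  apply: measurableI => //; rewrite -[X in measurable X]setTI.
  exact: measurable_ev.
by apply/seteqP; split=> w; rewrite /rays/= in_itv/= => /andP.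
Qed.

Lemma ray_cylinders_generate : @measurable _ cpath = <<s ray_cylinders >>.
Proof.
apply/seteqP; split; last first.
  apply: smallest_sub; first exact: sigma_algebra_measurable.
  by move=> _ [l _ <-]; exact: measurable_rays.
pose C : measurableType _ := g_sigma_algebraType ray_cylinders.
apply: smallest_sub; first exact: smallest_sigma_algebra.
move=> _ [s [B [mB ->]]].
have mev : measurable_fun setT (fun w : C => (w : cpath) s : R).
  apply: (measurability _ (RGenInftyO.measurableE R)) => _ [_ [a ->] <-].
  apply: sub_sigma_algebra; exists [:: (s, a)] => //.
  by apply/seteqP; split=> w; rewrite /rays/= in_itv/= andbT => // -[].
by rewrite -[X in <<s _ >> X]setTI; exact: mev.
Qed.

End paths.

(** * The Cameron-Martin formula on cylinder sets *)

(** The law of a Brownian motion is prescribed through increments over consecutive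
    intervals. The grid starts at 0 so that path values are sums of increments,
    and is strictly increasing so that the increments have positive variances. *)
Lemma sorted_grid (R : realType) (T : R) (F : seq R) : 0 <= T ->
  all (fun x => 0 <= x <= T) F ->
  exists (n : nat) (tau : nat -> R), [/\ tau 0%N = 0,
    forall i, (i < n)%N -> tau i < tau i.+1, tau n <= T &
    forall x, x \in F -> exists2 k, (k <= n)%N & tau k = x].
Proof.
move=> T0 /allP FT.
pose s := sort <=%R (undup (0 :: F)).
have ss : sorted <%R s by rewrite sort_lt_sorted undup_uniq.
have ms x : (x \in s) = (x \in 0 :: F) by rewrite mem_sort mem_undup.
have s0 : (0 < size s)%N.
  by rewrite -has_predT; apply/hasP; exists 0 => //; rewrite ms mem_head.
have sT x : x \in s -> 0 <= x <= T.
  by rewrite ms inE => /predU1P[->|/FT//]; rewrite lexx.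
exists (size s).-1, (nth 0 s); split.
- have /(nthP 0)[i si i0] : 0 \in s by rewrite ms mem_head.
  apply/eqP; rewrite eq_le; apply/andP; split; last first.
    by have /andP[] := sT _ (mem_nth 0 s0).
  rewrite -[leRHS]i0.
  by apply: (sorted_leq_nth le_trans lexx) => //; exact: sort_le_sorted.
- move=> i ilt; apply: (sorted_ltn_nth lt_trans) => //; rewrite inE.
    by rewrite (ltn_trans ilt)// prednK.
  by rewrite -ltn_predRL.
- have : nth 0 s (size s).-1 \in s by apply: mem_nth; rewrite prednK.
  by move=> /sT/andP[].
- move=> x xF; have /(nthP 0)[i si <-] : x \in s by rewrite ms inE xF orbT.
  by exists i => //; rewrite -ltnS prednK.
Qed.

(** A sum up to k written as a sum over the whole grid with 0-1 coefficients: the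
    coefficients are the directions in which the Gaussian vector of increments
    is translated. *)
Lemma telescope_prefix (R : realType) n k (f : nat -> R) : (k <= n)%N ->
  \sum_(i < n) (i < k)%N%:R * (f i.+1 - f i) = f k - f 0%N.
Proof.
move=> kn; rewrite -(big_mkord xpredT (fun i => (i < k)%N%:R * (f i.+1 - f i))).
rewrite (big_cat_nat _ kn)//= [X in _ + X]big1_seq ?addr0; last first.
  by move=> i /=; rewrite mem_index_iota => /andP[ki _]; rewrite ltnNge ki mul0r.
rewrite -telescope_sumr//; apply: eq_big_nat => i /andP[_ ->].
by rewrite mul1r.
Qed.

Section wiener.
Context (R : realType) (T : R) (hT : 0 < T).
Let Rm : measurableType _ := measurableTypeR R.
Local Notation cpath := (cpath T).
Variables (P : probability cpath R) (hP : is_wiener P).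

Lemma wiener_start_ae : {ae P, forall w : cpath, w 0 = 0 :> R}.
Proof.
have m0 : measurable [set w : cpath | w 0 = 0 :> R].
  rewrite (_ : [set _ | _] = (fun w : cpath => w 0 : R) @^-1` [set 0])//.
  by rewrite -[X in measurable X]setTI; exact: measurable_ev.
exists (~` [set w : cpath | w 0 = 0 :> R]); split => //; first exact: measurableC.
by have := probability_setC P m0; rewrite (wiener_start hP) subee.
Qed.

Section increments.
Variables (n : nat) (tau : nat -> R).
Hypotheses (tau0 : tau 0%N = 0) (tauS : forall i, (i < n)%N -> tau i < tau i.+1)
  (tauT : tau n <= T).

Definition increments (w : cpath) : n.-tuple Rm :=
  [tuple w (tau i.+1) - w (tau i) | i < n].

Lemma measurable_increments : measurable_fun setT increments.
Proof.
apply/measurable_fun_tnthP => i.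
rewrite (_ : _ \o _ = fun w : cpath => w (tau i.+1) - w (tau i)).
  by apply: measurable_funB; exact: measurable_ev.
by apply/funext => x /=; rewrite tnth_mktuple.
Qed.

Lemma incrementsD w h : increments (w + h) =
  shift_tuple (fun i => h (tau i.+1) - h (tau i)) (increments w).
Proof.
by apply: eq_from_tnth => i; rewrite !tnth_mktuple !cpathD opprD addrACA.
Qed.

Lemma tau_homo j k : (j <= k)%N -> (k <= n)%N -> tau j <= tau k.
Proof.
move=> + kn; elim: k kn => [|k IH] kn; first by rewrite leqn0 => /eqP ->.
rewrite leq_eqVlt => /predU1P[->//|]; rewrite ltnS => jk.
by rewrite (le_trans (IH (ltnW kn) jk))// ltW// tauS.
Qed.

Lemma tau_bounds i : (i <= n)%N -> 0 <= tau i <= T.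
Proof.
by move=> i_n; rewrite -{1}tau0 tau_homo//= (le_trans _ tauT)// tau_homo.
Qed.

(** On boxes both sides are the same product, the left one by independence. *)
Lemma law_increments (A : set (n.-tuple Rm)) : measurable A ->
  P (increments @^-1` A) = gauss_tuple (fun i => tau i.+1 - tau i) n A.
Proof.
pose X : {mfun cpath >-> n.-tuple Rm} := HB.pack increments
  (isMeasurableFun.Build _ _ _ _ _ measurable_increments).
move=> mA; change (distribution P X A = gauss_tuple (fun i => tau i.+1 - tau i) n A).
apply: (measure_unique (@boxes R n) (fun=> setT) (boxes_generate R n)
  (@boxes_setI R n)) => //.
- by move=> _; exists (fun=> setT); split => //; apply/seteqP; split.
- by rewrite bigcup_const//; exists 0%N.
- move=> _ [B [mB ->]].
  rewrite [RHS](gauss_rect _ _ mB) /distribution /pushforward.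
  transitivity (P [set w | forall i, (i < n)%N -> B i (w (tau i.+1) - w (tau i))]).
    congr (P _); apply/seteqP; split => w /= wB i.
      by move=> i_n; have := wB (Ordinal i_n); rewrite tnth_mktuple.
    by rewrite tnth_mktuple; exact: wB.
  have tau_ge0 : 0 <= tau 0%N by rewrite tau0.
  have tau_le i : (i < n)%N -> tau i <= tau i.+1 by move=> ?; rewrite ltW// tauS.
  rewrite (wiener_indep hP tau_ge0 tau_le tauT mB).
  apply: eq_bigr => i _; rewrite (wiener_normal hP)//.
  + by have H := tau_bounds (ltnW (ltn_ord i)); case/andP: H.
  + by apply: tauS.
  + by have H := tau_bounds (ltn_ord i); case/andP: H.
  + exact: mB.
- move=> _; apply: (le_lt_trans _ (ltry 1)).
  exact: (@probability_le1 _ _ _ (distribution P X) setT measurableT).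
Qed.

Lemma ge0_integral_increments (f : n.-tuple Rm -> \bar R) :
  measurable_fun setT f -> (forall x, 0 <= f x)%E ->
  (\int[P]_w f (increments w) =
   \int[gauss_tuple (fun i => tau i.+1 - tau i)%R n]_x f x)%E.
Proof.
pose X : {mfun cpath >-> n.-tuple Rm} := HB.pack increments
  (isMeasurableFun.Build _ _ _ _ _ measurable_increments).
move=> mf f0.
rewrite -[LHS](ge0_integral_pushforward measurable_increments P measurableT)//.
apply: eq_measure_integral; first exact: measurable_increments.
by move=> mi A mA _; exact: (law_increments mA).
Qed.

End increments.

Definition cm_density (e s : R) (w : cpath) : \bar R :=
  (expR (e * w s - e ^+ 2 * s / 2))%:E.

Lemma measurable_cm_density e s : measurable_fun setT (cm_density e s).
Proof.
apply/measurable_EFinP; apply: measurableT_comp => //.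
apply: measurable_funB => //; apply: measurable_funM => //.
exact: measurable_ev.
Qed.

(** On a grid through s and the times of l, the increments of [cov_path T s] are
    the lengths of the intervals before s, and 0 after s. Translating the path by
    e times [cov_path T s] thus translates each normal increment by a_i times its
    variance, where a_i is e before s and 0 after s. In the density of
    [gauss_shift] the increments before s add up to w s and their variances
    to s. *)
Lemma cameron_martin_rays (e s : R) (l : seq (R * R)) : 0 <= s <= T ->
  (\int[P]_w (\1_(rays l) (w + e *: cov_path T s))%:E =
   \int[P]_w ((\1_(rays l) w)%:E * cm_density e s w))%E.
Proof.
move=> sT.
pose F := s :: map (fun p => clamp T p.1) l.
have T0 := ltW hT.
have FT : all (fun x => 0 <= x <= T) F.
  by rewrite /= sT/=; apply/allP => x /mapP[p _ ->]; exact: clamp_bounds.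
have [n [tau [tau0 tauS tauT tauF]]] := sorted_grid T0 FT.
have /cid2[k kn taus] := tauF s (mem_head _ _).
have tauB := tau_bounds tau0 tauS tauT.
have /choice[idx idxP] : forall p : R * R, exists k, p \in l ->
    (k <= n)%N /\ tau k = clamp T p.1.
  move=> p; have [pl|pl] := boolP (p \in l); last by exists 0%N.
  have [|j jn tauj] := tauF (clamp T p.1); last by exists j.
  by rewrite inE; apply/orP; right; apply/mapP; exists p.
(* The path value at the j-th grid time. Subtracting 0 gives the linear form the
   shape required by [measurable_tnth_sum]. *)
pose W (x : n.-tuple Rm) j := \sum_(i < n) ((i < j)%N%:R * tnth x i - 0).
have WE (w : cpath) j : (j <= n)%N -> w 0 = 0 -> W (increments n tau w) j = w (tau j).
  move=> jn w0; have := telescope_prefix (fun i => w (tau i) : R) jn.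
  rewrite tau0 w0 subr0 => <-.
  by apply: eq_bigr => i _; rewrite tnth_mktuple subr0.
pose A : set (n.-tuple Rm) := [set x | all (fun p => W x (idx p) < p.2) l].
have mA : measurable A.
  rewrite /A; elim: (l) => [|p l' IH].
    by rewrite (_ : [set _ | _] = setT)//; apply/seteqP; split.
  rewrite (_ : [set _ | _] = (fun x => W x (idx p)) @^-1` `]-oo, p.2[ `&`
      [set x | all (fun p => W x (idx p) < p.2) l']).
    apply: measurableI => //; rewrite -[X in measurable X]setTI.
    have mW := @measurable_tnth_sum R n (fun i => (i < idx p)%N%:R) (fun=> 0).
    exact: mW.
  by apply/seteqP; split=> x /=; rewrite in_itv/= => /andP.
have AE (w : cpath) : w 0 = 0 -> (increments n tau w \in A) = (w \in rays l).
  move=> w0; apply/idP/idP; rewrite !inE /A /rays/= => /allP H.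
    apply/allP => p pl; have [pn pt] := idxP _ pl.
    by have := H _ pl; rewrite WE// pt -cpath_clamp.
  apply/allP => p pl; have [pn pt] := idxP _ pl.
  by rewrite WE// pt -cpath_clamp; exact: H.
pose a (i : nat) := e * (i < k)%N%:R.
pose v i := tau i.+1 - tau i.
have hE (w : cpath) : increments n tau (w + e *: cov_path T s) =
    shift_tuple (fun i => a i * v i) (increments n tau w).
  rewrite incrementsD; apply: eq_from_tnth => i; rewrite !tnth_mktuple.
  congr (_ + _); rewrite !cpathZ -mulrBr -mulrA; congr (_ * _).
  rewrite !cov_pathE ?tauB//; last by rewrite ltnW.
  rewrite -taus; case: ltnP => ik.
    have h1 := tau_homo tauS ik kn; have h2 := tau_homo tauS (ltnW ik) kn.
    by rewrite mul1r !min_r.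
  have h1 := tau_homo tauS ik (ltnW (ltn_ord i)).
  have h2 := tau_homo tauS (leqW ik) (ltn_ord i).
  by rewrite mul0r !min_l// subrr.
have mrays := @measurable_rays R T l.
have m1 : measurable_fun setT (fun w : cpath => (\1_(rays l) w)%:E : \bar R).
  by apply/measurable_EFinP; exact: measurable_indic.
have m1A : measurable_fun setT (fun x => (\1_A x)%:E : \bar R).
  by apply/measurable_EFinP; exact: measurable_indic.
have mi := @measurable_increments n tau.
transitivity (\int[P]_w (\1_A
    (shift_tuple (fun i => a i * v i)%R (increments n tau w)))%:E)%E.
  apply: ge0_ae_eq_integral => //.
  - exact: (measurableT_comp m1 (measurable_translate _)).
  - apply: (measurableT_comp m1A); apply: measurableT_comp => //.
    exact: measurable_shift_tuple.
  - apply: filterS wiener_start_ae => w w0 _; rewrite -hE !indicE AE//.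
    by rewrite cpathD cpathZ w0 cov_pathE ?lexx// min_r ?mulr0 ?addr0; case/andP: sT.
have v0 i : (i < n)%N -> 0 < v i by move=> i_n; rewrite subr_gt0 tauS.
rewrite (ge0_integral_increments tau0 tauS tauT
  (f := fun x => (\1_A (shift_tuple (fun i => a i * v i)%R x))%:E)); last 2 first.
- by apply: (measurableT_comp m1A); exact: measurable_shift_tuple.
- by move=> x; rewrite lee_fin.
rewrite (gauss_shift a v0 m1A)//.
rewrite -(ge0_integral_increments tau0 tauS tauT (f := fun x => ((\1_A x)%:E *
  (expR (\sum_(i < n) (a i * tnth x i - a i ^+ 2 * v i / 2))%R)%:E)%E)); last 2 first.
- apply: emeasurable_funM => //; apply/measurable_EFinP.
  apply: measurableT_comp => //.
  exact: (@measurable_tnth_sum R n a (fun i => a i ^+ 2 * v i / 2)).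
- by move=> x; rewrite mule_ge0// lee_fin expR_ge0.
apply: ge0_ae_eq_integral => //.
- apply: emeasurable_funM; first exact: (measurableT_comp m1A).
  apply/measurable_EFinP; apply: measurableT_comp => //.
  exact: (measurableT_comp
    (@measurable_tnth_sum R n a (fun i => a i ^+ 2 * v i / 2)) mi).
- by apply: emeasurable_funM => //; exact: measurable_cm_density.
- by move=> x _; rewrite mule_ge0// lee_fin expR_ge0.
apply: filterS wiener_start_ae => w w0 _; rewrite !indicE AE//.
congr (_ * (expR _)%:E)%E; rewrite sumrB; congr (_ - _).
  rewrite -taus -(WE _ _ kn w0) mulr_sumr; apply: eq_bigr => i _.
  by rewrite /a subr0 mulrA.
have := telescope_prefix tau kn; rewrite tau0 subr0 taus => <-.
rewrite mulr_sumr mulr_suml.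
apply: eq_bigr => i _; rewrite /a /v; case: ltnP => _; last first.
  by rewrite mulr0n mulr0 mul0r expr2 !mul0r mulr0 mul0r.
by rewrite !mulr1 mul1r.
Qed.

End wiener.

(** * The Cameron-Martin formula *)
Section cm.
Context (R : realType) (T : R) (hT : 0 < T).
Local Notation cpath := (cpath T).
Variables (P : probability cpath R) (hP : is_wiener P).

(** The Cameron-Martin formula along h. Here l is the Wiener integral of h and k
    is half of its squared norm; as k disappears upon differentiation at e = 0,
    it is kept as a parameter. *)
Definition shift_formula (h : cpath) (l : cpath -> R) (k : R) : Prop :=
  forall (e : R) (F : cpath -> \bar R),
    measurable_fun setT F -> (forall w, 0 <= F w)%E ->
  (\int[P]_w F (w + e *: h)%R =
   \int[P]_w (F w * (expR (e * l w - e ^+ 2 * k))%:E))%E.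

(** The law of the translated path and the law with density [cm_density e s] are
    finite measures that agree on ray cylinders by [cameron_martin_rays]; the
    empty list of rays shows that their total masses are equal. *)
Lemma shift_formula_cov s : 0 <= s <= T ->
  shift_formula (cov_path T s) (fun w => w s) (s / 2).
Proof.
move=> sT e F mF F0.
have md := @measurable_cm_density R T e s.
have rT : rays [::] = [set: cpath] by apply/seteqP; split.
have d1 : (\int[P]_w cm_density e s w = 1)%E.
  have := cameron_martin_rays hT hP e [::] sT; rewrite rT.
  rewrite (_ : (\int[P]_w _)%E = \int[P]_w cst 1%E w)%E; last first.
    by apply: eq_integral => w _; rewrite indicT.
  rewrite integral_cst//= mul1e probability_setT => ->.
  by apply: eq_integral => w _; rewrite indicT mul1e.
have iD : P.-integrable setT (cm_density e s).
  apply/integrableP; split => //; under eq_integral.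
    by move=> w _; rewrite gee0_abs ?lee_fin ?expR_ge0//; over.
  by rewrite d1 ltry.
have mt := @measurable_translate R T (e *: cov_path T s).
pose X : {mfun cpath >-> cpath} := HB.pack (fun w : cpath => w + e *: cov_path T s)
  (isMeasurableFun.Build _ _ _ _ _ mt).
have nuE A : measurable A ->
    (pushforward P X A = \int[P]_(w in A) cm_density e s w)%E.
  move=> mA; rewrite /pushforward.
  have i1 : P.-integrable setT (cst 1%E : cpath -> \bar R).
    exact: finite_measure_integrable_cst.
  have mXA : measurable (X @^-1` A).
    by rewrite -[Y in measurable Y]setTI; exact: (mt measurableT _ mA).
  have <- : (\int[P]_(w in X @^-1` A) cst 1%E w = P (X @^-1` A))%E.
    by rewrite integral_cst// mul1e.
  apply: (pi_lambda_integral mt (@measurable_id _ cpath setT) i1 iD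
    (@ray_cylinders_generate R T) (@ray_cylinders_setI R T) _ _ mA).
  - by rewrite integral_cst//= mul1e probability_setT d1.
  - move=> _ [l _ <-]; have ml := @measurable_rays R T l.
    rewrite preimage_id [in LHS]integral_mkcond [in RHS]integral_mkcond.
    transitivity (\int[P]_w (\1_(rays l) (w + e *: cov_path T s)%R)%:E)%E.
      apply: eq_integral => w _.
      rewrite patchE indicE.
      have -> : (w \in X @^-1` rays l) = (w + e *: cov_path T s \in rays l).
        by apply/idP/idP; rewrite !inE.
      by case: ifP.
    rewrite cameron_martin_rays//; apply: eq_integral => w _.
    by rewrite patchE indicE; case: ifP; rewrite ?mul1e ?mul0e.
rewrite -[LHS](ge0_integral_pushforward mt P measurableT)//.
rewrite -[LHS]/(\int[pushforward P X]_w F w)%E.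
have -> := ge0_integral_density (mu := P) (nu := pushforward P X) (fun w => expR_ge0 _)
  _ nuE mF F0; last by apply/measurable_EFinP.
  by apply: eq_integral => w _; rewrite mulrA.
exact: mt.
Qed.

Lemma shift_formula0 : shift_formula 0 (fun=> 0) 0.
Proof.
move=> e F mF F0; apply: eq_integral => w _.
by rewrite scaler0 addr0 !mulr0 subr0 expR0 mule1.
Qed.

Lemma shift_formulaZ c h l k : shift_formula h l k ->
  shift_formula (c *: h) (fun w => c * l w) (c ^+ 2 * k).
Proof.
move=> H e F mF F0; under eq_integral do rewrite scalerA.
rewrite H//; apply: eq_integral => w _.
by congr (_ * (expR _)%:E)%E; ring.
Qed.

(** Translate along h1, then along h2. The second translation changes l1 by the
    constant e l1(h2), which contributes the inner product of h1 and h2 to half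
    of the squared norm of h1 + h2. *)
Lemma shift_formulaD (h1 : cpath) (l1 : cpath -> R) k1 h2 l2 k2 :
  (forall e w, l1 (w + e *: h2) = l1 w + e * l1 h2) -> measurable_fun setT l1 ->
  shift_formula h1 l1 k1 -> shift_formula h2 l2 k2 ->
  shift_formula (h1 + h2) (fun w => l1 w + l2 w) (k1 + k2 + l1 h2).
Proof.
move=> l1D ml1 H1 H2 e F mF F0.
transitivity (\int[P]_w F (w + e *: h1 + e *: h2)%R)%E.
  by apply: eq_integral => w _; rewrite scalerDr addrA.
rewrite (H1 e (fun w => F (w + e *: h2)))//; last first.
  exact: (measurableT_comp mF (measurable_translate _)).
pose G w := (F w * (expR (e * (l1 w - e * l1 h2) - e ^+ 2 * k1))%:E)%E.
transitivity (\int[P]_w G (w + e *: h2)%R)%E.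
  by apply: eq_integral => w _; rewrite /G l1D addrK.
rewrite H2; last 2 first.
- apply: emeasurable_funM => //; apply/measurable_EFinP.
  apply: measurableT_comp => //; apply: measurable_funB => //.
  by apply: measurable_funM => //; exact: measurable_funB.
- by move=> w; rewrite mule_ge0// lee_fin expR_ge0.
apply: eq_integral => w _; rewrite /G -muleA -EFinM -expRD.
by congr (_ * (expR _)%:E)%E; ring.
Qed.

(** A list of coefficients and times describes at once an element of the
    Cameron-Martin space and, by [ev_comb], its Wiener integral. *)
Definition cov_comb (r : seq (R * R)) : cpath :=
  \sum_(p <- r) p.1 *: cov_path T p.2.

Definition ev_comb (r : seq (R * R)) (w : cpath) : R :=
  \sum_(p <- r) p.1 * w p.2.

Lemma measurable_ev_comb r : measurable_fun setT (ev_comb r).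
Proof.
apply: measurable_sum => p; apply: measurable_funM => //; exact: measurable_ev.
Qed.

Lemma shift_formula_comb r : all (fun p => 0 <= p.2 <= T) r ->
  exists k, shift_formula (cov_comb r) (ev_comb r) k.
Proof.
elim: r => [_|[c s] r IH /= /andP[sT /IH[k Hk]]].
  exists 0 => e F mF F0; rewrite /cov_comb big_nil shift_formula0//.
  by apply: eq_integral => w _; rewrite /ev_comb big_nil.
exists (c ^+ 2 * (s / 2) + k + c * cov_comb r s) => e F mF F0.
have := @shift_formulaD _ (fun w : cpath => c * w s) _ _ _ _ _ _
  (shift_formulaZ c (shift_formula_cov sT)) Hk e F mF F0.
rewrite /cov_comb big_cons => ->.
- by apply: eq_integral => w _; rewrite /ev_comb big_cons.
- by move=> e' w; rewrite cpathD cpathZ; ring.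
- by apply: measurable_funM => //; exact: measurable_ev.
Qed.

End cm.

(** * Functionals of exponential growth *)
Lemma dominated_convergenceR d (X : measurableType d) (R : realType)
    (mu : {measure set X -> \bar R}) (f_ : nat -> X -> R) (f g : X -> R) :
  (forall n, measurable_fun setT (f_ n)) ->
  (forall x, f_ n x @[n --> \oo] --> f x) ->
  mu.-integrable setT (EFin \o g) ->
  (forall n x, `|f_ n x| <= g x) ->
  mu.-integrable setT (EFin \o f) /\
  ((\int[mu]_x (f_ n x)%:E)%E @[n --> \oo] --> (\int[mu]_x (f x)%:E)%E).
Proof.
move=> mf_ f_f ig fg.
have mf : measurable_fun setT f by apply: (measurable_fun_cvg mf_) => x _; exact: f_f.
have [] := @dominated_convergence _ _ R mu setT measurableT
  (fun n x => (f_ n x)%:E) (EFin \o f) (EFin \o g).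
- by move=> n; exact/measurable_EFinP.
- exact/measurable_EFinP.
- by apply: aeW => x _; apply: cvg_EFin (f_f x); exact: nearW.
- exact: ig.
- by apply: aeW => x n _; rewrite lee_fin.
by [].
Qed.

Lemma cvg_diff_quotient (R : realType) (f : R -> R) :
  derivable f 0 1 ->
  (f n.+1%:R^-1 - f 0) * n.+1%:R @[n --> \oo] --> derive1 f 0.
Proof.
move=> df; rewrite derive1E.
have h0 : (n.+1%:R^-1 : R) @[n --> \oo] --> (0 : R)^'.
  move=> A [e /= e0 eA]; have := @cvg_harmonic R.
  move=> /cvgrPdist_lt /(_ e e0); apply: filterS => n /= ne; apply: eA.
    by rewrite /= /ball_ /=.
  by rewrite invr_eq0 pnatr_eq0.
have := cvg_comp _ _ h0 df.
apply: cvg_trans; apply: near_eq_cvg; apply: nearW => n /=.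
by rewrite invrK addr0 [_%:A]mulr1 mulrC.
Qed.

Section subexp.
Context (R : realType) (T : R) (hT : 0 < T).
Local Notation cpath := (cpath T).
Variables (P : probability cpath R) (hP : is_wiener P).

Definition pathsum (l : seq R) (w : cpath) : R := \sum_(s <- l) `|w s|.

Lemma pathsum_ge0 l w : 0 <= pathsum l w.
Proof. exact: sumr_ge0. Qed.

Lemma pathsum_cat l l' w : pathsum (l ++ l') w = pathsum l w + pathsum l' w.
Proof. by rewrite /pathsum big_cat. Qed.

Lemma measurable_pathsum l : measurable_fun setT (pathsum l).
Proof.
apply: measurable_sum => s; apply: measurableT_comp => //; exact: measurable_ev.
Qed.

(** A class that is closed under sums and products, contains path values and
    bounded functionals, and has only integrable members once they are
    measurable ([integrable_exp_bounded]): it settles all integrability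
    questions below. *)
Definition exp_bounded (X : cpath -> R) : Prop := exists (A B : R) (l : seq R),
  [/\ 0 <= A, 0 <= B & forall w, `|X w| <= A * expR (B * pathsum l w)].

Lemma exp_bounded_le X Y : (forall w, `|X w| <= `|Y w|) ->
  exp_bounded Y -> exp_bounded X.
Proof.
move=> XY [A [B [l [A0 B0 H]]]]; exists A, B, l; split => // w.
exact: le_trans (XY w) (H w).
Qed.

Lemma exp_bounded_bounded X M : (forall w, `|X w| <= M) -> exp_bounded X.
Proof.
move=> XM; exists M, 0, [::]; split => //; first exact: le_trans (XM 0).
by move=> w; rewrite mul0r expR0 mulr1.
Qed.

Lemma exp_bounded_pathsum l : exp_bounded (pathsum l).
Proof.
exists 1, 1, l; split => // w; rewrite ger0_norm ?pathsum_ge0// !mul1r.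
by apply: le_trans (expR_ge1Dx _); rewrite lerDr.
Qed.

Lemma exp_bounded_ev s : exp_bounded (fun w => w s).
Proof.
apply: exp_bounded_le (exp_bounded_pathsum [:: s]) => w.
by rewrite /pathsum big_seq1 normr_id.
Qed.

Lemma exp_boundedD X Y : exp_bounded X -> exp_bounded Y ->
  exp_bounded (fun w => X w + Y w).
Proof.
move=> [A [B [l [A0 B0 H]]]] [A' [B' [l' [A'0 B'0 H']]]].
exists (A + A'), (B + B'), (l ++ l'); split; rewrite ?addr_ge0// => w.
apply: le_trans (ler_normD _ _) _; rewrite mulrDl; apply: lerD.
  apply: le_trans (H w) _; apply: ler_wpM2l => //; rewrite ler_expR pathsum_cat.
  by have := pathsum_ge0 l w; have := pathsum_ge0 l' w; nra.
apply: le_trans (H' w) _; apply: ler_wpM2l => //; rewrite ler_expR pathsum_cat.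
by have := pathsum_ge0 l w; have := pathsum_ge0 l' w; nra.
Qed.

Lemma exp_boundedM X Y : exp_bounded X -> exp_bounded Y ->
  exp_bounded (fun w => X w * Y w).
Proof.
move=> [A [B [l [A0 B0 H]]]] [A' [B' [l' [A'0 B'0 H']]]].
exists (A * A'), (B + B'), (l ++ l'); split; rewrite ?mulr_ge0 ?addr_ge0// => w.
rewrite normrM; apply: le_trans (ler_pM _ _ (H w) (H' w)) _ => //.
rewrite mulrACA -expRD; apply: ler_wpM2l; first exact: mulr_ge0.
rewrite ler_expR pathsum_cat.
by have := pathsum_ge0 l w; have := pathsum_ge0 l' w; nra.
Qed.

Lemma exp_bounded_cst c : exp_bounded (fun=> c).
Proof. by apply: (@exp_bounded_bounded _ `|c|). Qed.

Lemma exp_bounded_norm X : exp_bounded X -> exp_bounded (fun w => `|X w|).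
Proof. by apply: exp_bounded_le => w; rewrite normr_id. Qed.

Lemma exp_bounded_ev_comb r : exp_bounded (ev_comb r).
Proof.
elim: r => [|p r IH].
  by apply: (exp_bounded_bounded (M := 0)) => w; rewrite /ev_comb big_nil normr0.
apply: exp_bounded_le (exp_boundedD (exp_boundedM (exp_bounded_cst p.1)
  (exp_bounded_ev p.2)) IH) => w.
by rewrite /ev_comb big_cons.
Qed.

Lemma ev_comb_le r : exists2 C, 0 <= C & exists l, forall w : cpath,
  `|ev_comb r w| <= C * pathsum l w.
Proof.
elim: r => [|p r [C C0 [l H]]].
  by exists 0 => //; exists [::] => w; rewrite /ev_comb big_nil normr0 mul0r.
exists (`|p.1| + C); first by rewrite addr_ge0.
exists (p.2 :: l) => w; rewrite /ev_comb /pathsum !big_cons.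
apply: le_trans (ler_normD _ _) _; rewrite normrM.
have := H w; rewrite /ev_comb /pathsum => Hw.
have := pathsum_ge0 l w; rewrite /pathsum => l0.
by have := normr_ge0 p.1; have := normr_ge0 (w p.2); nra.
Qed.

(** The exponential moment of a single path value is read off from the shift
    formula for the constant functional 1. The exponential of a sum is at most
    the sum of the exponentials of twice each of its terms, which gives the
    induction on l. *)
Lemma integrable_exp_pathsum B l : 0 <= B ->
  P.-integrable setT (fun w => (expR (B * pathsum l w))%:E).
Proof.
have m B' l' : measurable_fun setT (fun w => (expR (B' * pathsum l' w))%:E).
  apply/measurable_EFinP; apply: measurableT_comp => //.
  by apply: measurable_funM => //; exact: measurable_pathsum.
have me c s : P.-integrable setT (fun w : cpath => (expR (c * w s))%:E).
  have mc : measurable_fun setT (fun w : cpath => (expR (c * w s))%:E).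
    apply/measurable_EFinP; apply: measurableT_comp => //.
    by apply: measurable_funM => //; exact: measurable_ev.
  apply/integrableP; split => //; under eq_integral do rewrite gee0_abs ?lee_fin ?expR_ge0//.
  have cT := clamp_bounds s hT.
  have := shift_formula_cov hT hP cT c (F := cst 1%E) (measurable_cst _) (fun=> lee01).
  rewrite integral_cst//= probability_setT mule1 => E.
  rewrite (_ : (\int[P]_w _)%E = (expR (c ^+ 2 * (clamp T s / 2)))%:E *
      \int[P]_w (cst 1 w * (expR (c * w (clamp T s) - c ^+ 2 * (clamp T s / 2)))%:E))%E.
    by rewrite -E mule1 ltry.
  rewrite -ge0_integralZl//.
  - apply: eq_integral => w _; rewrite mul1e -EFinM -expRD addrC subrK.
    by rewrite -cpath_clamp.
  - apply: emeasurable_funM => //; apply/measurable_EFinP.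
    apply: measurableT_comp => //; apply: measurable_funB => //.
    by apply: measurable_funM => //; exact: measurable_ev.
  - by move=> w _; rewrite mule_ge0// lee_fin expR_ge0.
elim: l B => [|s l IH] B B0.
  have i1 := finite_measure_integrable_cst P 1 (measurableT : measurable [set: cpath]).
  apply: (eq_integrable measurableT _ _ _ i1).
  by move=> w _; rewrite /pathsum big_nil mulr0 expR0.
have B20 : 0 <= 2 * B by rewrite mulr_ge0.
have i2 := integrableD measurableT (integrableD measurableT (me (2 * B) s)
  (me (- (2 * B)) s)) (IH (2 * B) B20).
apply: (le_integrable measurableT (m B (s :: l)) _ i2).
move=> w _; rewrite /= lee_fin !ger0_norm ?addr_ge0 ?expR_ge0//.
rewrite /pathsum big_cons -/(pathsum l w).
have e1 : expR (2 * B * `|w s|) <= expR (2 * B * w s) + expR (- (2 * B) * w s).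
  have := expR_ge0 (2 * B * w s); have := expR_ge0 (- (2 * B) * w s).
  case: (ger0P (w s)) => _; first by move=> *; rewrite lerDl.
  by rewrite mulrN -mulNr => *; rewrite lerDr.
have e2 : expR (B * (`|w s| + pathsum l w)) <=
    expR (2 * B * `|w s|) + expR (2 * B * pathsum l w).
  have h1 := expR_ge0 (2 * B * `|w s|); have h2 := expR_ge0 (2 * B * pathsum l w).
  have [h|h] := leP `|w s| (pathsum l w).
    by apply: ler_wpDl => //; rewrite ler_expR; nra.
  by apply: ler_wpDr => //; rewrite ler_expR; nra.
lra.
Qed.

Lemma integrable_exp_bounded X : measurable_fun setT X -> exp_bounded X ->
  P.-integrable setT (EFin \o X).
Proof.
move=> mX [A [B [l [A0 B0 H]]]].
have i := integrableZl measurableT A (integrable_exp_pathsum l B0).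
apply: (le_integrable measurableT _ _ i) => //; first exact/measurable_EFinP.
move=> w _ /=; rewrite lee_fin (le_trans (H w))//.
by rewrite normrM (ger0_norm A0) (ger0_norm (expR_ge0 _)).
Qed.

End subexp.

(** * Integration by parts *)
Section tame.
Context (R : realType) (T : R) (hT : 0 < T).
Local Notation cpath := (cpath T).
Variables (P : probability cpath R) (hP : is_wiener P).

(** The functionals that may be differentiated along h under the expectation.
    The bound on the derivative holds at all paths and therefore, through
    [is_derive_line] and the mean value theorem, also bounds the difference
    quotients. *)
Definition tame (h : cpath) (F : cpath -> R) : Prop :=
  [/\ measurable_fun setT F, exp_bounded F,
      forall w : cpath, derivable (fun e : R => F (w + e *: h)) 0 1 &
      exp_bounded (dir_deriv F h)].

Lemma cvg_dir_deriv h (F : cpath -> R) w : derivable (fun e : R => F (w + e *: h)) 0 1 ->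
  (F (w + n.+1%:R^-1 *: h) - F w) * n.+1%:R @[n --> \oo] --> dir_deriv F h w.
Proof.
move=> /cvg_diff_quotient; apply: cvg_trans; apply: near_eq_cvg.
by apply: nearW => n /=; rewrite scale0r addr0.
Qed.

Lemma measurable_dir_deriv h (F : cpath -> R) : measurable_fun setT F ->
  (forall w : cpath, derivable (fun e : R => F (w + e *: h)) 0 1) ->
  measurable_fun setT (dir_deriv F h).
Proof.
move=> mF dF.
apply: (@measurable_fun_cvg _ _ _ _
  (fun n (w : cpath) => (F (w + n.+1%:R^-1 *: h) - F w) * n.+1%:R)).
  move=> n; apply: measurable_funM => //; apply: measurable_funB => //.
  exact: (measurableT_comp mF (measurable_translate _)).
by move=> w _; exact: cvg_dir_deriv.
Qed.

(** The line through w may be re-based at each of its points, so that a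
    derivative at 0 for all base points is a derivative everywhere. *)
Lemma is_derive_line h (F : cpath -> R) :
  (forall w : cpath, derivable (fun e : R => F (w + e *: h)) 0 1) ->
  forall w (x : R), is_derive x 1 (fun e : R => F (w + e *: h))
    (dir_deriv F h (w + x *: h)).
Proof.
move=> dF w x.
pose f e := F (w + e *: h); pose g e := F (w + x *: h + e *: h).
have fg e : f (e + x) = g e by rewrite /f /g scalerDl [e *: h + _]addrC addrA.
have E : (fun k : R => k^-1 *: ((f \o shift x) (k *: 1) - f x)) =
         (fun k : R => k^-1 *: ((g \o shift 0) (k *: 1) - g 0)).
  apply/funext => k /=; rewrite addr0 fg; congr (_ *: (_ - _)).
  by rewrite -fg add0r.
have D := dF (w + x *: h).
have ED : 'D_1 f x = 'D_1 g 0 by rewrite /derive E.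
split; first by rewrite /derivable E.
by rewrite /dir_deriv derive1E; exact: ED.
Qed.

Lemma pathsum_shift l (w h : cpath) (c : R) : `|c| <= 1 ->
  pathsum l (w + c *: h) <= pathsum l w + pathsum l h.
Proof.
move=> c1; rewrite /pathsum -big_split /=; apply: ler_sum => s _.
rewrite -[X in `|X| <= _]/(w s + c * h s); apply: le_trans (ler_normD _ _) _.
by rewrite lerD2l normrM ler_piMl.
Qed.

Lemma norm_expRB1 (x : R) : `|expR x - 1| <= `|x| * expR `|x|.
Proof.
have := expR_ge1Dx x; have := expR_ge1Dx (- x); have ex := expR_gt0 x.
have eN : expR (- x) * expR x = 1 by rewrite -expRD addNr expR0.
have [x0|x0] := ger0P x.
  move=> h1 h2; rewrite ger0_norm; last by lra.
  nra.
move=> h1 h2; rewrite ler0_norm; last first.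
  by rewrite subr_le0 -expR0 ler_expR ltW.
have := expR_ge1Dx (- x); have e1 : 1 <= expR (- x) by rewrite -expR0 ler_expR; lra.
nra.
Qed.

Lemma shift_formulaR h l k : shift_formula P h l k -> measurable_fun setT l ->
  forall e F, measurable_fun setT F ->
  (\int[P]_w (F (w + e *: h)%R)%:E =
   \int[P]_w (F w * expR (e * l w - e ^+ 2 * k))%:E)%E.
Proof.
move=> H ml e F mF.
rewrite [LHS]integralE [RHS]integralE; congr (_ - _)%E.
- transitivity (\int[P]_w ((EFin \o F)^\+ (w + e *: h)%R))%E.
    by apply: eq_integral => w _; rewrite !funeposE.
  rewrite H; last 2 first.
  + by apply: measurable_funepos; exact/measurable_EFinP.
  + by move=> w; exact: funepos_ge0.
  apply: eq_integral => w _; rewrite !funeposE /= -!EFin_max -EFinM.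
  by congr EFin; rewrite maxr_pMl ?mul0r// expR_ge0.
- transitivity (\int[P]_w ((EFin \o F)^\- (w + e *: h)%R))%E.
    by apply: eq_integral => w _; rewrite !funenegE.
  rewrite H; last 2 first.
  + by apply: measurable_funeneg; exact/measurable_EFinP.
  + by move=> w; exact: funeneg_ge0.
  apply: eq_integral => w _; rewrite !funenegE /= -!EFin_max -EFinM.
  by congr EFin; rewrite maxr_pMl ?mul0r ?mulNr// expR_ge0.
Qed.

(** Both sides are derivatives at e = 0 of the two sides of the shift formula
    E F(w + e h) = E F(w) exp(e l(w) - e^2 k), taken along e = 1 / (n + 1) under
    the expectation by dominated convergence. *)
Lemma wiener_integration_by_parts r F : all (fun p => 0 <= p.2 <= T) r ->
  tame (cov_comb T r) F ->
  (\int[P]_w (dir_deriv F (cov_comb T r) w)%:E = \int[P]_w (F w * ev_comb r w)%:E)%E.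
Proof.
move=> rT [mF [A [B [l [A0 B0 HF]]]] dF [A' [B' [l' [A'0 B'0 HD]]]]].
have [k Hk] := shift_formula_comb hT hP rT.
set h := cov_comb T r in dF HD Hk *.
have ml := @measurable_ev_comb R T r.
pose e n : R := n.+1%:R^-1.
have e0 n : 0 < e n by rewrite invr_gt0.
have e1 n : e n <= 1 by rewrite invf_le1// ler1n.
have mFe n : measurable_fun setT (fun w : cpath => F (w + e n *: h)).
  exact: (measurableT_comp mF (measurable_translate _)).
have md n : measurable_fun setT
    (fun w : cpath => expR (e n * ev_comb r w - e n ^+ 2 * k) : R).
  apply: measurableT_comp => //; apply: measurable_funB => //.
  by apply: measurable_funM.
(* Difference quotients of the translated functional; the mean value theorem
   turns each of them into a directional derivative at a nearby path. *)
have [_ L] : P.-integrable setT (EFin \o dir_deriv F h) /\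
    ((\int[P]_w (((F (w + e n *: h) - F w) * n.+1%:R)%R)%:E)%E @[n --> \oo] -->
     (\int[P]_w (dir_deriv F h w)%:E)%E).
  apply: (dominated_convergenceR (g := fun w : cpath => A' * expR (B' * pathsum l' h) *
    expR (B' * pathsum l' w))).
  - by move=> n; apply: measurable_funM => //; exact: measurable_funB.
  - by move=> w; exact: cvg_dir_deriv.
  - under [X in _.-integrable _ X]eq_fun do rewrite /= EFinM.
    by apply: integrableZl => //; exact: (integrable_exp_pathsum hT hP).
  - move=> n w.
    have [|c] := @MVT R (fun x => F (w + x *: h)) (fun x => dir_deriv F h (w + x *: h))
       0 (e n) (e0 n) (fun x _ => is_derive_line dF w x).
      apply: derivable_within_continuous => x _.
      by case: (is_derive_line dF w x).
    rewrite in_itv/= => /andP[c0 ce]; rewrite scale0r addr0 subr0 => ->.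
    rewrite -mulrA mulVf// mulr1.
    apply: le_trans (HD _) _; rewrite -mulrA ler_wpM2l// -expRD ler_expR -mulrDr.
    rewrite ler_wpM2l// [leRHS]addrC pathsum_shift// ger0_norm ?(ltW c0)//.
    exact: le_trans (ltW ce) (e1 n).
(* Difference quotients of the density, whose derivative at 0 is
   [ev_comb r] since k only enters through e^2 k. *)
have [C C0 [l1 Hl]] := @ev_comb_le R T r.
have [_ Rr] : P.-integrable setT (EFin \o (fun w : cpath => F w * ev_comb r w)) /\
    ((\int[P]_w ((F w * ((expR (e n * ev_comb r w - e n ^+ 2 * k) - 1) * n.+1%:R))%R)%:E)%E
      @[n --> \oo] --> (\int[P]_w ((F w * ev_comb r w))%:E)%E).
  pose g w := F w * ((`|ev_comb r w| + `|k|) * expR (`|k| + C * pathsum l1 w)).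
  apply: (dominated_convergenceR (g := fun w : cpath => `|g w|)).
  - move=> n; apply: measurable_funM => //; apply: measurable_funM => //.
    exact: measurable_funB.
  - move=> w; apply: cvgM; first exact: cvg_cst.
    pose f (x : R) := expR (x * ev_comb r w - x ^+ 2 * k).
    have df : is_derive (0 : R) 1 f (ev_comb r w).
      rewrite /f; apply: is_derive_eq.
      rewrite expr0n /= !mul0r subrr expR0 mul1r.
      by rewrite !(scaler0, scale0r, addr0, add0r) subr0; exact: mulr1.
    have /cvg_diff_quotient : derivable f 0 1 by case: df.
    rewrite derive1E; case: df => _ ->.
    by rewrite /f mul0r expr0n /= mul0r subrr expR0.
  - apply: (integrable_exp_bounded hT hP).
      apply: measurableT_comp => //; apply: measurable_funM => //.
      apply: measurable_funM.
        by apply: measurable_funD => //; exact: measurableT_comp.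
      apply: measurableT_comp => //; apply: measurable_funD => //.
      by apply: measurable_funM => //; exact: measurable_pathsum.
    apply: exp_bounded_norm; apply: exp_boundedM; first by exists A, B, l.
    apply: exp_boundedM.
      apply: exp_boundedD; last exact: exp_bounded_cst.
      by apply: exp_bounded_norm; exact: exp_bounded_ev_comb.
    exists (expR `|k|), C, l1; split => // w.
    by rewrite -expRD ger0_norm// expR_ge0.
  - move=> n w; rewrite /g !normrM ler_wpM2l//.
    set x := e n * _ - _.
    have xle : `|x| <= e n * (`|ev_comb r w| + `|k|).
      apply: le_trans (ler_normB _ _) _.
      rewrite normrM [X in _ + X]normrM normrX (ger0_norm (ltW (e0 n))) mulrDr lerD2l.
      by rewrite ler_wpM2r// expr2 ler_piMl// ltW.
    have xle1 : `|x| <= `|k| + C * pathsum l1 w.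
      apply: le_trans xle _.
      have := Hl w; have := e0 n; have := e1 n; have := normr_ge0 k.
      by have := normr_ge0 (ev_comb r w); nra.
    have nE : `|n.+1%:R : R| = (e n)^-1 by rewrite invrK ger0_norm.
    rewrite nE (ger0_norm (expR_ge0 _)) [X in _ <= X * _]ger0_norm ?addr_ge0//.
    rewrite ler_pdivrMr// mulrAC.
    apply: le_trans (norm_expRB1 x) _.
    apply: ler_pM => //.
      by rewrite mulrC.
    by rewrite ler_expR.
have bF : exp_bounded F by exists A, B, l.
have bFe n : exp_bounded (fun w : cpath => F (w + e n *: h)).
  exists (A * expR (B * pathsum l h)), B, l; split => //.
    by rewrite mulr_ge0// expR_ge0.
  move=> w; apply: le_trans (HF _) _; rewrite -mulrA ler_wpM2l// -expRD ler_expR.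
  rewrite -mulrDr ler_wpM2l// [leRHS]addrC pathsum_shift//.
  by rewrite ger0_norm ?e1// ltW.
have bd n : exp_bounded (fun w : cpath => expR (e n * ev_comb r w - e n ^+ 2 * k)).
  exists (expR `|k|), C, l1; split => // w.
  rewrite -expRD ger0_norm ?expR_ge0// ler_expR.
  have := Hl w; have := e0 n; have := e1 n; have := normr_ge0 k.
  have := normr_ge0 (ev_comb r w); have := ler_norm (ev_comb r w).
  have := ler_norm (- k); rewrite normrN.
  have : e n ^+ 2 <= 1 by rewrite exprn_ile1// ltW.
  have : 0 <= e n ^+ 2 by rewrite exprn_ge0// ltW.
  nra.
have int X := @integrable_exp_bounded R T hT P hP X.
suff E n : (\int[P]_w (((F (w + e n *: h) - F w) * n.+1%:R)%R)%:E =
    \int[P]_w ((F w * ((expR (e n * ev_comb r w - e n ^+ 2 * k) - 1) * n.+1%:R))%R)%:E)%E.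
  by move: L; under eq_fun do rewrite E; move=> L; exact: (cvg_unique _ L Rr).
have mFd : measurable_fun setT
  (fun w : cpath => F w * expR (e n * ev_comb r w - e n ^+ 2 * k)).
  exact: measurable_funM.
transitivity (n.+1%:R%:E * (\int[P]_w (F (w + e n *: h)%R)%:E - \int[P]_w (F w)%:E))%E.
  rewrite -integralB_EFin//; [|exact: int|exact: int].
  rewrite -integralZl//; last by apply: integrableB => //; exact: int.
  by apply: eq_integral => w _; rewrite -EFinB -EFinM mulrC.
rewrite (shift_formulaR Hk)//.
rewrite -integralB_EFin//; [|by apply: int => //; exact: exp_boundedM|exact: int].
rewrite -integralZl//; last first.
  by apply: integrableB => //; apply: int => //; exact: exp_boundedM.
by apply: eq_integral => w _; rewrite -EFinB -EFinM; congr EFin; ring.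
Qed.
End tame.

(** * Measurability by discretization *)
Section grid_approximation.
Context (R : realType).

Lemma measurable_countable_glue d (X : measurableType d) (I : countType)
    (phi : X -> I) (G : I -> X -> R) :
  (forall i, measurable (phi @^-1` [set i])) ->
  (forall i, measurable_fun setT (G i)) ->
  measurable_fun setT (fun x => G (phi x) x).
Proof.
move=> mphi mG _ Y mY; rewrite setTI.
rewrite (_ : _ @^-1` Y = \bigcup_i (phi @^-1` [set i] `&` G i @^-1` Y)).
  apply: countable_bigcupT_measurable; first exact: countableP.
  move=> i; apply: measurableI => //; rewrite -[Z in measurable Z]setTI.
  exact: mG.
apply/seteqP; split => x /=; first by move=> Yx; exists (phi x).
by move=> [i _ [/= -> ]].
Qed.

Definition grid_floor (n : nat) (x : R) : int := Num.floor (x * n.+1%:R).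

Definition grid_point (n : nat) (z : int) : R := z%:~R / n.+1%:R.

Lemma grid_approx n x : `|x - grid_point n (grid_floor n x)| <= n.+1%:R^-1.
Proof.
have /real_floor_itv/andP[h1 h2] : x * n.+1%:R \is Num.real by exact: num_real.
have n0 : 0 < n.+1%:R :> R by [].
have E : grid_point n (grid_floor n x) * n.+1%:R = (grid_floor n x)%:~R.
  by rewrite /grid_point divfK// gt_eqF.
have hx : x - grid_point n (grid_floor n x) =
    (x * n.+1%:R - (grid_floor n x)%:~R) / n.+1%:R.
  by rewrite -E -mulrBl mulfK// gt_eqF.
rewrite hx normrM [X in _ * X]ger0_norm ?invr_ge0// -[leRHS]mul1r ler_wpM2r//.
rewrite rmorphD /= in h2.
rewrite ger0_norm ?subr_ge0// lerBlDl /grid_floor; exact: ltW.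
Qed.

Lemma cvg_grid x : grid_point n (grid_floor n x) @[n --> \oo] --> x.
Proof.
apply/cvgrPdist_le => e e0; near=> n.
apply: le_trans (grid_approx n x) _.
near: n; have /cvgrPdist_le/(_ e e0) := @cvg_harmonic R.
by apply: filterS => n /=; rewrite sub0r normrN ger0_norm// invr_ge0.
Unshelve. all: by end_near. Qed.

Lemma measurable_grid_floor n (z : int) : measurable (grid_floor n @^-1` [set z]).
Proof.
pose f (x : R) := x * n.+1%:R.
have mf : measurable_fun setT f by apply: measurable_funM.
rewrite (_ : _ @^-1` _ = f @^-1` `[z%:~R, (z + 1)%:~R[).
  by rewrite -[Z in measurable Z]setTI; exact: mf.
apply/seteqP; split => x /=; rewrite in_itv /grid_floor /f /=.
  by move=> <-; exact/real_floor_itv/num_real.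
by move=> H; exact: floor_def.
Qed.

(** Rounding every coordinate down to a grid of mesh 1 / (n + 1) leaves countably
    many values of x; by continuity f \o x is the limit of the rounded maps. *)
Lemma measurable_continuous_rV d (X : measurableType d) m
    (x : X -> 'rV[R]_m) (f : 'rV[R]_m -> R) :
  (forall i, measurable_fun setT (fun u => x u 0 i)) -> continuous f ->
  measurable_fun setT (f \o x).
Proof.
move=> mx cf.
pose phi n u : 'rV[int]_m := \row_i grid_floor n (x u 0 i).
pose g n (z : 'rV[int]_m) := f (\row_i grid_point n (z 0 i)).
apply: (@measurable_fun_cvg _ _ _ _ (fun n u => g n (phi n u))).
  move=> n; apply: (measurable_countable_glue (G := fun z _ => g n z)) => z.
    rewrite (_ : _ @^-1` _ =
        \bigcap_(i in [set: 'I_m]) ((fun u => x u 0 i) @^-1` (grid_floor n @^-1` [set z 0 i]))).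
      apply: fin_bigcap_measurable => // i _; rewrite -[Z in measurable Z]setTI.
      by apply: mx => //; exact: measurable_grid_floor.
    apply/seteqP; split => u /=; first by move=> <- i _ /=; rewrite mxE.
    by move=> H; apply/rowP => i; rewrite mxE; exact: H.
  exact: measurable_cst.
move=> u _; apply: (cvg_comp (fun n => \row_i grid_point n (phi n u 0 i)) f); last exact: cf.
apply/cvg_ballP => e e0; near=> n; split => // i j; rewrite !mxE (ord1 i).
rewrite /ball /= (le_lt_trans (grid_approx n _))//.
near: n; have /cvgrPdist_lt/(_ e e0) := @cvg_harmonic R.
by apply: filterS => n /=; rewrite sub0r normrN ger0_norm// invr_ge0.
Unshelve. all: by end_near. Qed.

(** Rounding the time down to a grid leaves countably many evaluations, each of
    them measurable; continuity of the path gives the limit. This joint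
    measurability is what Fubini's theorem in time and path requires. *)
Lemma measurable_path_eval (T : R) :
  measurable_fun setT (fun x : measurableTypeR R * cpath T => x.2 x.1 : R).
Proof.
apply: (@measurable_fun_cvg _ _ _ _
  (fun n (x : measurableTypeR R * cpath T) => x.2 (grid_point n (grid_floor n x.1)))).
  move=> n; apply: (measurable_countable_glue
      (phi := fun x : measurableTypeR R * cpath T => grid_floor n x.1)
      (G := fun z x => x.2 (grid_point n z))) => z.
    rewrite -[Z in measurable Z]setTI.
    exact: (measurable_fst measurableT _ (measurable_grid_floor n z)).
  exact: (measurableT_comp (measurable_ev (grid_point n z)) measurable_snd).
move=> [x w] _ /=.
exact: (@cvg_comp _ _ _ (fun n => grid_point n (grid_floor n x)) (cpath_fun w : R -> R)
  _ _ _ (@cvg_grid x) (@cpath_continuous R T w x)).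
Qed.

End grid_approximation.

(** * Duality for cylindrical polynomials *)
Section tame_algebra.
Context (R : realType) (T : R).
Local Notation cpath := (cpath T).
Implicit Types (F G Q : cpath -> R) (h : cpath).

Lemma tame_derivable h F : tame h F -> forall w : cpath,
  is_derive (0 : R) 1 (fun e : R => F (w + e *: h)) (dir_deriv F h w).
Proof.
by move=> [_ _ dF _] w; split => //; rewrite /dir_deriv derive1E.
Qed.

(** Pairing tameness with the value of the derivative lets one rule per operation
    both prove regularity and compute. *)
Lemma tame_intro h F D : measurable_fun setT F -> exp_bounded F -> exp_bounded D ->
  (forall w : cpath, is_derive (0 : R) 1 (fun e : R => F (w + e *: h)) (D w)) ->
  tame h F /\ dir_deriv F h = D.
Proof.
move=> mF bF bD H.
have E : dir_deriv F h = D.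
  by apply/funext => w; rewrite /dir_deriv derive1E; case: (H w).
by split => //; split => //; rewrite E.
Qed.

Lemma tame_cst h c : tame h (fun=> c) /\ dir_deriv (fun=> c) h = fun=> 0.
Proof.
apply: tame_intro => //; [exact: exp_bounded_cst|exact: exp_bounded_cst|].
by move=> w; exact: is_derive_cst.
Qed.

Lemma tame_ev h s : tame h (fun w => w s) /\
  dir_deriv (fun w : cpath => w s : R) h = fun=> h s.
Proof.
apply: tame_intro; [exact: measurable_ev|exact: exp_bounded_ev|exact: exp_bounded_cst|].
move=> w; have E : (fun e : R => (w + e *: h) s : R) = (fun e : R => w s + e * h s).
  by apply/funext => e.
apply: is_derive_eq; rewrite scale0r !add0r mul1r; exact: mulr1.
Qed.

Lemma tameD h F G : tame h F -> tame h G -> tame h (fun w => F w + G w) /\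
  dir_deriv (fun w => F w + G w) h = fun w => dir_deriv F h w + dir_deriv G h w.
Proof.
move=> tF tG; have dF := tame_derivable tF; have dG := tame_derivable tG.
case: tF => mF bF _ bF'; case: tG => mG bG _ bG'.
apply: tame_intro.
- exact: measurable_funD.
- exact: exp_boundedD.
- exact: exp_boundedD.
Qed.

Lemma tameM h F G : tame h F -> tame h G -> tame h (fun w => F w * G w) /\
  dir_deriv (fun w => F w * G w) h =
  fun w => F w * dir_deriv G h w + G w * dir_deriv F h w.
Proof.
move=> tF tG; have dF := tame_derivable tF; have dG := tame_derivable tG.
case: tF => mF bF _ bF'; case: tG => mG bG _ bG'.
apply: tame_intro.
- exact: measurable_funM.
- exact: exp_boundedM.
- by apply: exp_boundedD; exact: exp_boundedM.
- move=> w; have := is_deriveM (dF w) (dG w).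
  by rewrite scale0r addr0.
Qed.

(** The iterated divergences are, almost surely, of this form. The class is closed
    under directional derivatives and under [poly_div], and all its members are
    tame in all directions ([cyl_poly_tame]). *)
Inductive cyl_poly : (cpath -> R) -> Prop :=
| cyl_poly_cst c : cyl_poly (fun=> c)
| cyl_poly_ev s : cyl_poly (fun w => w s)
| cyl_polyD F G : cyl_poly F -> cyl_poly G -> cyl_poly (fun w => F w + G w)
| cyl_polyM F G : cyl_poly F -> cyl_poly G -> cyl_poly (fun w => F w * G w).

Lemma cyl_poly_tame h Q : cyl_poly Q -> tame h Q /\ cyl_poly (dir_deriv Q h).
Proof.
elim => {Q} [c|s|F G _ [tF pF] _ [tG pG]|F G pF0 [tF pF] pG0 [tG pG]].
- by have [? ->] := tame_cst h c; split => //; exact: cyl_poly_cst.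
- by have [? ->] := tame_ev h s; split => //; exact: cyl_poly_cst.
- by have [? ->] := tameD tF tG; split => //; exact: cyl_polyD.
- by have [? ->] := tameM tF tG; split => //; apply: cyl_polyD; exact: cyl_polyM.
Qed.

Lemma cyl_poly_ev_comb r : cyl_poly (ev_comb r).
Proof.
elim: r => [|p r IH].
  rewrite (_ : ev_comb _ = fun=> 0); first exact: cyl_poly_cst.
  by apply/funext => w; rewrite /ev_comb big_nil.
rewrite (_ : ev_comb _ = fun w => p.1 * w p.2 + ev_comb r w).
  apply: cyl_polyD => //; apply: cyl_polyM; first exact: cyl_poly_cst.
  exact: cyl_poly_ev.
by apply/funext => w; rewrite /ev_comb big_cons.
Qed.

(** The divergence of Q h for h = [cov_comb T r], where [ev_comb r] is the
    divergence of h. *)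
Definition poly_div (r : seq (R * R)) (Q : cpath -> R) (w : cpath) : R :=
  Q w * ev_comb r w - dir_deriv Q (cov_comb T r) w.

Lemma cyl_poly_div r Q : cyl_poly Q -> cyl_poly (poly_div r Q).
Proof.
move=> pQ; rewrite (_ : poly_div _ _ =
    fun w => Q w * ev_comb r w + -1 * dir_deriv Q (cov_comb T r) w).
  apply: cyl_polyD; first by apply: cyl_polyM => //; exact: cyl_poly_ev_comb.
  by apply: cyl_polyM; [exact: cyl_poly_cst|case: (cyl_poly_tame (cov_comb T r) pQ)].
by apply/funext => w; rewrite mulN1r.
Qed.

Section duality.
Hypothesis hT : 0 < T.
Variables (P : probability cpath R) (hP : is_wiener P).

(** Integration by parts for the product F Q, whose derivative along h is
    F D_h Q + Q D_h F. *)
Lemma duality_poly r F Q : all (fun p => 0 <= p.2 <= T) r ->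
  tame (cov_comb T r) F -> cyl_poly Q ->
  (\int[P]_w (dir_deriv F (cov_comb T r) w * Q w)%:E =
   \int[P]_w (F w * poly_div r Q w)%:E)%E.
Proof.
move=> rT tF pQ; have [tQ pQ'] := cyl_poly_tame (cov_comb T r) pQ.
have [tFQ dFQ] := tameM tF tQ.
have := wiener_integration_by_parts hT hP rT tFQ; rewrite dFQ.
set h := cov_comb T r in tF tQ tFQ dFQ pQ' *.
have mD := measurable_dir_deriv.
case: tF => mF bF dF bF'; case: (tQ) => mQ bQ dQ bQ'.
have mF' := mD _ _ _ _ mF dF; have mQ' := mD _ _ _ _ mQ dQ.
have ml := @measurable_ev_comb R T r; have bl := @exp_bounded_ev_comb R T r.
have int X := @integrable_exp_bounded R T hT P hP X.
have mFQ' : measurable_fun setT (fun w => F w * dir_deriv Q h w).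
  exact: measurable_funM.
have mF'Q : measurable_fun setT (fun w => dir_deriv F h w * Q w).
  exact: measurable_funM.
have mFQl : measurable_fun setT (fun w => F w * Q w * ev_comb r w).
  by apply: measurable_funM => //; exact: measurable_funM.
have i1 := int _ mFQ' (exp_boundedM bF bQ').
have i2 := int _ mF'Q (exp_boundedM bF' bQ).
have i3 := int _ mFQl (exp_boundedM (exp_boundedM bF bQ) bl).
move=> E.
transitivity (\int[P]_w (F w * Q w * ev_comb r w)%:E -
              \int[P]_w (F w * dir_deriv Q h w)%:E)%E; last first.
  rewrite -integralB_EFin//; apply: eq_integral => w _.
  by rewrite /poly_div -EFinB; congr EFin; ring.
rewrite -E -integralB_EFin//; last first.
  apply: int; first by apply: measurable_funD => //; exact: measurable_funM.
  by apply: exp_boundedD; exact: exp_boundedM.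
by apply: eq_integral => w _; rewrite -EFinB; congr EFin; ring.
Qed.
End duality.

End tame_algebra.

Section smooth_cylindrical.
Context (R : realType) (T : R).
Local Notation cpath := (cpath T).

Lemma smooth_cylindrical_tame h (F : cpath -> R) : smooth_cylindrical F -> tame h F.
Proof.
move=> [m [tau [f [tauT [df cdf [M fM] bdf] FE]]]].
pose x (w : cpath) : 'rV[R]_m := \row_i w (tau i).
have {}FE : F = f \o x by apply/funext => w; rewrite FE.
have [M' fM'] := bdf (x h).
have cf : continuous f by move=> y; exact: differentiable_continuous.
have line w : (fun e : R => F (w + e *: h)) = (fun e : R => f (e *: x h + x w)).
  apply/funext => e; rewrite FE /=; congr f; apply/rowP => i.
  by rewrite !mxE addrC.
suff [] : tame h F /\ dir_deriv F h = (fun w => 'D_(x h) f (x w)) by [].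
apply: tame_intro.
- rewrite FE; apply: measurable_continuous_rV => // i.
  rewrite (_ : (fun _ => _) = fun w : cpath => w (tau i) : R).
    exact: measurable_ev.
  by apply/funext => w; rewrite mxE.
- by rewrite FE; apply: (@exp_bounded_bounded _ _ _ M) => w; exact: fM.
- by apply: (@exp_bounded_bounded _ _ _ M') => w; exact: fM'.
- move=> w; rewrite line; split.
    by apply: (derivable1P f (x w) (x h)).1; exact: diff_derivable.
  rewrite /derive; set g1 := fun _ => _; set g2 := fun _ => _.
  suff -> : g1 = g2 by [].
  apply/funext => k; rewrite /g1 /g2 /=.
  by rewrite addr0 scale0r add0r [k *: 1]mulr1.
Qed.

End smooth_cylindrical.

(** * Uniqueness of the divergence *)
Section test_functions.
Context (R : realType).

Lemma is_derive_bigsum n (h : 'I_n -> R -> R) (dh : 'I_n -> R) (x : R) :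
  (forall i, is_derive x 1 (h i) (dh i)) ->
  is_derive x 1 (fun e => \sum_(i < n) h i e) (\sum_(i < n) dh i).
Proof.
move=> H; rewrite (_ : (fun _ => _) = \sum_(i < n) h i); first exact: is_derive_sum.
by apply/funext => e; rewrite fct_sumE.
Qed.

Variables (m : nat) (alpha : R) (beta : 'I_m -> R).

Definition bump_exp (x : 'rV[R]_m) : R :=
  \sum_(i < m) expR (alpha * x 0 i + beta i).

(** Explicit test functions: bounded by 1, and with bounded derivatives because
    y exp(- y) <= 1 for y >= 0. For large alpha and suitable beta they are close
    to the indicator of a product of left half-lines. *)
Definition bump (x : 'rV[R]_m) : R := expR (- bump_exp x).

Let dterm i (x : 'rV[R]_m) :
  differentiable (fun y : 'rV[R]_m => expR (alpha * y 0 i + beta i)) x.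
Proof.
apply: (@differentiable_comp _ _ _ _ (fun y : 'rV[R]_m => alpha * y 0 i + beta i) expR).
  apply: differentiableD => //; apply: differentiableM => //.
  exact: differentiable_coord.
by apply/derivable1_diffP; exact: derivable_expR.
Qed.

Lemma differentiable_bump x : differentiable bump x.
Proof.
apply: (@differentiable_comp _ _ _ _ (fun y => - bump_exp y) expR); last first.
  by apply/derivable1_diffP; exact: derivable_expR.
apply: differentiableN.
rewrite (_ : bump_exp = \sum_(i < m) (fun y : 'rV[R]_m => expR (alpha * y 0 i + beta i))).
  by apply: differentiable_sum.
by apply/funext => y; rewrite fct_sumE.
Qed.

Definition bump_deriv (v x : 'rV[R]_m) : R :=
  bump x * (- \sum_(i < m) expR (alpha * x 0 i + beta i) * (alpha * v 0 i)).

Lemma derive_bump v x : 'D_v bump x = bump_deriv v x.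
Proof.
pose g (e : R) := bump (e *: v + x).
transitivity ('D_1 g 0).
  rewrite /derive; set g1 := fun _ => _; set g2 := fun _ => _.
  suff -> : g1 = g2 by [].
  apply/funext => k; rewrite /g1 /g2 /g /=.
  by rewrite addr0 scale0r add0r [k *: 1]mulr1.
suff : is_derive (0 : R) 1 g (bump_deriv v x) by case.
have E : g = (fun e : R => expR (- \sum_(i < m)
    expR (alpha * (e * v 0 i + x 0 i) + beta i))).
  apply/funext => e; rewrite /g /bump /bump_exp; congr (expR (- _)).
  by apply: eq_bigr => i _; rewrite !mxE.
have d i : is_derive (0 : R) 1
    (fun e : R => expR (alpha * (e * v 0 i + x 0 i) + beta i))
    (expR (alpha * x 0 i + beta i) * (alpha * v 0 i)).
  apply: is_derive_eq; rewrite mul0r add0r.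
  by rewrite scale0r add0r !addr0 [_%:A]mulr1.
have := @is_derive1_comp _ expR _ 0 _ _ (is_derive_expR _) (is_deriveN (is_derive_bigsum d)).
rewrite /comp -E => H; apply: is_derive_eq H _.
rewrite /bump_deriv /bump /bump_exp; congr (_ * - _).
by congr (expR (- _)); apply: eq_bigr => i _; rewrite mul0r add0r.
Qed.

Lemma bump_le1 x : 0 <= bump x <= 1.
Proof.
rewrite expR_ge0 /= -[leRHS]expR0 ler_expR oppr_le0.
by apply: sumr_ge0 => i _; exact: expR_ge0.
Qed.

Lemma C1b_rV_bump : C1b_rV bump.
Proof.
split.
- exact: differentiable_bump.
- move=> v x.
  rewrite (_ : (fun _ => _) = bump_deriv v); last exact/funext/derive_bump.
  apply: differentiable_continuous; apply: differentiableM.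
    exact: differentiable_bump.
  apply: differentiableN.
  rewrite (_ : (fun _ => _) = \sum_(i < m) (fun y : 'rV[R]_m =>
      expR (alpha * y 0 i + beta i) * (alpha * v 0 i))).
    by apply: differentiable_sum => i; exact: differentiableM.
  by apply/funext => y; rewrite fct_sumE.
- by exists 1 => x; have /andP[b0 b1] := bump_le1 x; rewrite ger0_norm.
- move=> v; exists (\sum_(i < m) `|alpha * v 0 i|) => x.
  rewrite derive_bump /bump_deriv mulrN normrN mulr_sumr.
  apply: le_trans (ler_norm_sum _ _ _) _; apply: ler_sum => i _.
  rewrite [bump x * _]mulrA normrM ler_piMl// ger0_norm ?mulr_ge0 ?expR_ge0//.
  set y := expR _; have y0 : 0 <= y by exact: expR_ge0.
  have yb : y <= bump_exp x.
    rewrite /bump_exp (bigD1 i)//= lerDl; apply: sumr_ge0 => j _.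
    exact: expR_ge0.
  have h1 := expR_ge1Dx (bump_exp x).
  rewrite /bump expRN ler_pdivrMl ?expR_gt0// mulr1; lra.
Qed.

End test_functions.

Section uniqueness.
Context (R : realType) (T : R) (hT : 0 < T).
Local Notation cpath := (cpath T).
Variables (P : probability cpath R) (hP : is_wiener P).

(** For the constraint w p.1 < p.2, and with m = n + 1, the inner exponent is
    m^2 (w p.1 - p.2) + m. It tends to - oo if the constraint holds, and is at
    least m otherwise: the term m is there for the boundary case w p.1 = p.2. *)
Definition ray_bump (n : nat) (l : seq (R * R)) (w : cpath) : R :=
  expR (- \sum_(p <- l)
    expR (n.+1%:R ^+ 2 * w p.1 + (n.+1%:R - n.+1%:R ^+ 2 * p.2))).

Lemma smooth_ray_bump n l : smooth_cylindrical (ray_bump n l).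
Proof.
pose p (i : 'I_(size l)) := tnth (in_tuple l) i.
exists (size l), (fun i => clamp T (p i).1),
  (bump (n.+1%:R ^+ 2) (fun i => n.+1%:R - n.+1%:R ^+ 2 * (p i).2)); split.
- by move=> i; exact: clamp_bounds.
- exact: C1b_rV_bump.
- move=> w; rewrite /ray_bump /bump /bump_exp big_tnth.
  by congr (expR (- _)); apply: eq_bigr => i _; rewrite mxE -cpath_clamp.
Qed.

Lemma expRN_le_harmonic n : expR (- n.+1%:R) <= harmonic n :> R.
Proof.
rewrite expRN /harmonic /= lef_pV2 ?posrE ?expR_gt0//.
by apply: le_trans (expR_ge1Dx _); rewrite lerDr.
Qed.

Lemma cvg_ray_term (x a : R) : x < a ->
  expR (n.+1%:R ^+ 2 * x + (n.+1%:R - n.+1%:R ^+ 2 * a)) @[n --> \oo] --> (0 : R).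
Proof.
move=> xa; apply: (squeeze_cvgr _ (cvg_cst 0) (@cvg_harmonic R)).
have d0 : 0 < (a - x) / 2 by rewrite divr_gt0// subr_gt0.
have /cvgrPdist_lt/(_ _ d0) := @cvg_harmonic R.
apply: filterS => n; rewrite /= sub0r normrN ger0_norm// => nd.
rewrite expR_ge0/=; apply: le_trans (expRN_le_harmonic n); rewrite ler_expR.
have n0 : 0 < n.+1%:R :> R by [].
have nd2 : 1 < (a - x) / 2 * n.+1%:R by rewrite -ltr_pdivrMr// div1r.
nra.
Qed.

Lemma cvg_ray_bump l w : ray_bump n l w @[n --> \oo] --> (\1_(rays l) w : R).
Proof.
have [wl|/allPn[p pl wp]] := boolP (all (fun p => w p.1 < p.2) l).
  have sum0 : \sum_(p <- l) expR (n.+1%:R ^+ 2 * w p.1 +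
      (n.+1%:R - n.+1%:R ^+ 2 * p.2)) @[n --> \oo] --> (0 : R).
    elim: l wl => [_|p l IH /= /andP[wp /IH wl]].
      apply: cvg_trans (@cvg_cst _ (0 : R) nat \oo _); apply: near_eq_cvg.
      by apply: nearW => n /=; rewrite big_nil.
    under eq_fun do rewrite big_cons.
    have H := cvgD (@cvg_ray_term _ _ wp) wl; rewrite addr0 in H; exact: H.
  have -> : (\1_(rays l) w : R) = expR 0 by rewrite indicE mem_set// expR0.
  apply: (cvg_comp _ expR); last exact: continuous_expR.
  have H := cvgN sum0; rewrite oppr0 in H; exact: H.
rewrite indicE memNset; last by move=> /allP/(_ _ pl); apply/negP.
apply: (squeeze_cvgr _ (cvg_cst 0) (@cvg_harmonic R)); apply: nearW => n.
rewrite expR_ge0/=; apply: le_trans (expRN_le_harmonic n).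
rewrite ler_expR lerN2 (big_rem p)//=.
rewrite -leNgt in wp.
have n0 : 0 < n.+1%:R :> R by [].
apply: (@le_trans _ _ (expR (n.+1%:R ^+ 2 * w p.1 + (n.+1%:R - n.+1%:R ^+ 2 * p.2)))).
  apply: le_trans (expR_ge1Dx _).
  have : 0 <= n.+1%:R ^+ 2 * (w p.1 - p.2) by rewrite mulr_ge0 ?sqr_ge0 ?subr_ge0.
  by rewrite mulrBr => ?; lra.
by rewrite lerDl; apply: sumr_ge0 => *; exact: expR_ge0.
Qed.

Lemma square_integrable_integrable (D : cpath -> R) : measurable_fun setT D ->
  (\int[P]_w ((D w) ^+ 2)%:E < +oo)%E -> P.-integrable setT (EFin \o D).
Proof.
move=> mD D2.
have i2 : P.-integrable setT (fun w => ((D w) ^+ 2)%:E).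
  apply/integrableP; split; first by apply/measurable_EFinP; exact: measurable_funX.
  by under eq_integral do rewrite gee0_abs ?lee_fin ?sqr_ge0//.
have i1 := finite_measure_integrable_cst P 1 (measurableT : measurable [set: cpath]).
have mE : measurable_fun setT (EFin \o D) by exact/measurable_EFinP.
apply: (le_integrable measurableT mE _ (integrableD measurableT i1 i2)) => w _ /=.
rewrite lee_fin [X in _ <= X]ger0_norm ?addr_ge0 ?sqr_ge0//.
by rewrite -[(D w) ^+ 2]real_normK ?num_real//; have := sqr_ge0 (`|D w| - 1); nra.
Qed.

(** Both versions have the same integral against all smooth cylindrical
    functionals, in particular against each [ray_bump]. In the limit their
    integrals over ray cylinders agree, hence also those over all events. *)
Lemma divergence_unique Z (D1 D2 : cpath -> R) :
  is_divergence P Z D1 -> is_divergence P Z D2 ->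
  {ae P, forall w, D1 w = D2 w}.
Proof.
move=> [_ mD1 D1oo H1] [_ mD2 D2oo H2].
have i1 := square_integrable_integrable mD1 D1oo.
have i2 := square_integrable_integrable mD2 D2oo.
have HE F : smooth_cylindrical F ->
    (\int[P]_w (F w * D1 w)%:E = \int[P]_w (F w * D2 w)%:E)%E.
  by move=> sF; have := H1 F sF; rewrite (H2 F sF) unlock.
have lim D l : measurable_fun setT D -> P.-integrable setT (EFin \o D) ->
  (\int[P]_w (ray_bump n l w * D w)%:E)%E @[n --> \oo] -->
    (\int[P]_(w in rays l) (D w)%:E)%E.
  move=> mD iD; rewrite integral_mkcond.
  rewrite (_ : (\int[P]_w _)%E = (\int[P]_w (\1_(rays l) w * D w)%:E)%E); last first.
    apply: eq_integral => w _; rewrite patchE indicE.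
    by case: ifP => _; rewrite ?mul1r ?mul0r.
  apply: (@dominated_convergenceR _ _ _ P (fun n w => ray_bump n l w * D w)
    (fun w => \1_(rays l) w * D w) (fun w => `|D w|) _ _ _ _).2.
  - move=> n; apply: measurable_funM => //.
    by have [] := smooth_cylindrical_tame 0 (smooth_ray_bump n l).
  - by move=> w; apply: cvgM; [exact: cvg_ray_bump|exact: cvg_cst].
  - exact: integrable_norm.
  - move=> n w; rewrite normrM ler_piMl// ger0_norm ?expR_ge0//.
    rewrite -[leRHS]expR0 ler_expR oppr_le0; apply: sumr_ge0 => *.
    exact: expR_ge0.
have rE l : (\int[P]_(w in rays l) (D1 w)%:E = \int[P]_(w in rays l) (D2 w)%:E)%E.
  have L1 := lim D1 l mD1 i1; have L2 := lim D2 l mD2 i2.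
  have E n : (\int[P]_w (ray_bump n l w * D2 w)%:E =
      \int[P]_w (ray_bump n l w * D1 w)%:E)%E.
    by rewrite HE//; exact: smooth_ray_bump.
  move: L2; under eq_fun do rewrite E; move=> L2.
  exact: (cvg_unique _ L1 L2).
have rT : rays [::] = [set: cpath] by apply/seteqP; split.
have AE A : measurable A ->
    (\int[P]_(w in A) (D1 w)%:E = \int[P]_(w in A) (D2 w)%:E)%E.
  move=> mA.
  have := pi_lambda_integral (@measurable_id _ cpath setT) (@measurable_id _ cpath setT)
    i1 i2 (@ray_cylinders_generate R T) (@ray_cylinders_setI R T) _ _ mA.
  rewrite preimage_id; apply; first by rewrite -rT; exact: rE.
  by move=> _ [l _ <-]; exact: rE.
have mE2 : measurable_fun setT (EFin \o D2) by exact/measurable_EFinP.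
have := integral_ae_eq measurableT i1 mE2 (fun E _ mE => AE E mE).
by apply: filterS => w /(_ I) [].
Qed.

End uniqueness.

(** * Existence of the divergence *)

(** Every subset of the finite exceptional set is measurable, so f is measurable
    because g is. *)
Lemma integral_eq_off_seq (R : realType) (N : seq R) (D : set R) (f g : R -> \bar R) :
  measurable D -> measurable_fun D g ->
  (forall x, D x -> x \notin N -> f x = g x) ->
  (\int[lebesgue_measure]_(x in D) f x = \int[lebesgue_measure]_(x in D) g x)%E.
Proof.
move=> mD mg fg.
have cN : countable [set` N] by apply: finite_set_countable; exact: finite_seq.
have mC (A : set R) : A `<=` [set` N] -> measurable A.
  move=> AN; apply: countable_measurable; last exact: sub_countable (subset_card_le AN) cN.
  by move=> x; exact: measurable_set1.
have mN : measurable [set` N] by exact: mC.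
have mf : measurable_fun D f.
  rewrite -(setUIDK D [set` N]); apply/measurable_funU.
  - exact: measurableI.
  - exact: measurableD.
  split.
    move=> _ Y mY; apply: mC => x [[_ ]] //.
  apply: (eq_measurable_fun g).
    by move=> x; rewrite inE => -[Dx /negP Nx]; rewrite fg.
  apply: measurable_funS mg => //; exact: subDsetl.
apply: ae_eq_integral => //.
exists [set` N]; split => //; first exact: countable_lebesgue_measure0.
move=> x /= H; apply: contrapT => /negP xN; apply: H => Dx; exact: fg.
Qed.

Section cm_norm.
Context (R : realType) (T : R) (hT : 0 < T).
Local Notation cpath := (cpath T).

Lemma is_derive_cov_path (a s : R) : 0 < s < T -> s != a ->
  is_derive s 1 (cov_path T a) ((s < a)%R%:R : R).
Proof.
move=> /andP[s0 sT] sa.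
have near_cl : \near s, clamp T s = s.
  have : \forall u \near s, 0 < u < T.
    by apply: (near_in_itvoo (a := 0) (b := T)); rewrite in_itv/= s0.
  by apply: filterS => u /andP[u0 uT]; rewrite clampE// !ltW.
move: sa; rewrite neq_lt => /orP[lt_sa|lt_as].
  rewrite lt_sa; apply: (@near_eq_is_derive _ _ _ id).
  near=> u; rewrite /= (near near_cl u)// min_r// ltW//.
  near: u; exact: lt_nbhsl.
rewrite ltNge (ltW lt_as); apply: (@near_eq_is_derive _ _ _ (cst a)).
  near=> u; rewrite /= (near near_cl u)// min_l// ltW//.
  near: u; exact: lt_nbhsr.
Unshelve. all: by end_near. Qed.

(** The derivative of [cov_comb T r] away from the times of r, where it has
    corners. *)
Definition cov_step (r : seq (R * R)) (s : R) : R := \sum_(p <- r) p.1 * (s < p.2)%R%:R.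

Lemma is_derive_cov_comb r c s : 0 < s < T -> s \notin map snd r ->
  is_derive s 1 (c *: cov_comb T r : cpath) (c * cov_step r s).
Proof.
move=> sT sr.
have H : is_derive s 1 (cov_comb T r : R -> R) (cov_step r s).
  elim: r sr => [_|p r IH].
    rewrite /cov_comb /cov_step !big_nil.
    exact: (is_derive_cst (0 : R)).
  rewrite /= inE negb_or => /andP[sp /IH sr].
  rewrite /cov_comb /cov_step !big_cons.
  have d1 := is_derive_cov_path sT sp.
  have := is_deriveD (is_deriveZ p.1 d1) sr.
  exact.
exact: (is_deriveZ c H).
Qed.

Lemma measurable_cov_step r : measurable_fun setT (cov_step r).
Proof.
apply: measurable_sum => p; apply: measurable_funM => //.
rewrite (_ : (fun _ => _) = (\1_(`]-oo, p.2[) : R -> R)); first exact: measurable_indic.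
by apply/funext => s; rewrite indicE mem_setE in_itv.
Qed.

Definition cov_comb_norm2 (r : seq (R * R)) : \bar R :=
  (\int[lebesgue_measure]_(s in `[0%R, T]) ((cov_step r s) ^+ 2)%R%:E)%E.

Lemma cm_norm2_cov_comb r c :
  (cm_norm2 (c *: cov_comb T r) = (c ^+ 2)%:E * cov_comb_norm2 r)%E.
Proof.
have m2 : measurable_fun `[0, T] (fun s => ((cov_step r s) ^+ 2)%:E : \bar R).
  apply: measurable_funTS; apply/measurable_EFinP; apply: measurable_funX.
  exact: measurable_cov_step.
rewrite /cm_norm2 (@integral_eq_off_seq _ (0 :: T :: map snd r) _ _
  (fun s => ((c ^+ 2)%:E * ((cov_step r s) ^+ 2)%:E)%E))//.
- by rewrite ge0_integralZl// ?lee_fin ?sqr_ge0// => s _; rewrite lee_fin sqr_ge0.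
- exact: measurable_funeM.
- move=> s; rewrite /= in_itv/= => /andP[s0 sT].
  rewrite !inE !negb_or => /and3P[sn0 snT sr].
  have sT' : 0 < s < T by rewrite !lt_neqAle s0 sT (eq_sym 0) sn0 snT.
  have := is_derive_cov_comb c sT' sr.
  by rewrite derive1E => -[_ ->]; rewrite -EFinM exprMn.
Qed.

Lemma cov_comb_norm2_lty r : (0 <= cov_comb_norm2 r < +oo)%E.
Proof.
rewrite integral_ge0 /=; last by move=> s _; rewrite lee_fin sqr_ge0.
pose M := \sum_(p <- r) `|p.1|.
have M0 : 0 <= M by apply: sumr_ge0.
apply: (@le_lt_trans _ _ (\int[lebesgue_measure]_(s in `[0%R, T]) (cst (M ^+ 2)%:E s))%E).
  apply: ge0_le_integral => //.
  - by move=> s _; rewrite lee_fin sqr_ge0.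
  - apply: measurable_funTS; apply/measurable_EFinP; apply: measurable_funX.
    exact: measurable_cov_step.
  - move=> s _; rewrite lee_fin -(real_normK (num_real _)) ler_sqr ?nnegrE//.
    apply: le_trans (ler_norm_sum _ _ _) _; apply: ler_sum => p _.
    by rewrite normrM; case: (s < p.2); rewrite ?normr1 ?mulr1// normr0 mulr0.
rewrite integral_cst//= lebesgue_measure_itv/= lte_fin hT oppr0 adde0 -EFinM.
exact: ltry.
Qed.

Lemma cov_path_lipschitz a u v : u <= v ->
  `|cov_path T a v - cov_path T a u| <= v - u :> R.
Proof.
by move=> uv; rewrite /= /clamp /Order.max /Order.min ler_norml; repeat case: ifPn;
  rewrite -?leNgt; lra.
Qed.

Lemma cov_comb_lipschitz r c : exists2 L, 0 < L & forall u v : R, u <= v ->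
  `|(c *: cov_comb T r) v - (c *: cov_comb T r) u| <= L * (v - u) :> R.
Proof.
exists (1 + `|c| * \sum_(p <- r) `|p.1|).
  by rewrite ltr_pwDl// mulr_ge0// sumr_ge0.
move=> u v uv; rewrite !cpathZ -mulrBr normrM.
suff : `|cov_comb T r v - cov_comb T r u| <= (\sum_(p <- r) `|p.1|) * (v - u) :> R.
  have := normr_ge0 c; have : 0 <= \sum_(p <- r) `|p.1| by apply: sumr_ge0.
  by rewrite mulrDl mul1r -mulrA; nra.
rewrite /cov_comb !cpath_sum -sumrB mulr_suml.
apply: le_trans (ler_norm_sum _ _ _) _; apply: ler_sum => p _.
by rewrite !cpathZ -mulrBr normrM ler_wpM2l// cov_path_lipschitz.
Qed.

Lemma cameron_martin_cov_comb r c : all (fun p => 0 <= p.2 <= T) r ->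
  cameron_martin (c *: cov_comb T r).
Proof.
move=> rT; split.
- rewrite cpathZ /cov_comb cpath_sum big_seq big1 ?mulr0// => p pr.
  have /andP[p0 pT] := allP rT _ pr.
  by rewrite cpathZ cov_pathE ?lexx ?ltW// min_r// mulr0.
- have [L L0 HL] := cov_comb_lipschitz r c.
  move=> e e0; exists (e / L); first exact: divr_gt0.
  move=> m u v uv _ sm.
  apply: (@le_lt_trans _ _ (\sum_(i < m) L * (v i - u i))).
    by apply: ler_sum => i _; apply: HL; have [] := uv i (ltn_ord i).
  by rewrite -mulr_sumr mulrC -ltr_pdivlMr.
- rewrite cm_norm2_cov_comb; have /andP[n0 noo] := cov_comb_norm2_lty r.
  by apply: lte_mul_pinfty => //; rewrite lee_fin sqr_ge0.
Qed.

End cm_norm.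

Section existence.
Context (R : realType) (T : R) (hT : 0 < T).
Local Notation cpath := (cpath T).
Variables (P : probability cpath R) (hP : is_wiener P).

(** The polynomial Q is a version of G, and for Q h the duality relation is
    [duality_poly]. The distinction between G and Q is forced by iteration: G is
    itself a divergence, hence known only up to a null set. *)
Lemma is_divergence_poly_div r (G Q : cpath -> R) :
  all (fun p => 0 <= p.2 <= T) r ->
  measurable_fun setT G -> {ae P, forall w, G w = Q w} -> cyl_poly Q ->
  is_divergence P (fun w => G w *: cov_comb T r) (poly_div r Q).
Proof.
move=> rT mG GQ pQ.
have poly (X : cpath -> R) : cyl_poly X -> measurable_fun setT X /\ exp_bounded X.
  by move=> pX; have [[]] := cyl_poly_tame 0 pX.
have [mQ bQ] := poly _ pQ.
have [mD bD] := poly _ (cyl_poly_div r pQ).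
have sq (X : cpath -> R) : measurable_fun setT X -> exp_bounded X ->
    (\int[P]_w ((X w) ^+ 2)%:E < +oo)%E.
  move=> mX bX.
  have m2 : measurable_fun setT (fun w => X w ^+ 2) by exact: measurable_funX.
  have b2 : exp_bounded (fun w => X w ^+ 2).
    by apply: exp_bounded_le (exp_boundedM bX bX) => w; rewrite expr2.
  exact: (integrable_lty _ (integrable_exp_bounded hT hP m2 b2)).
have mG2 : measurable_fun setT (fun w => ((G w) ^+ 2)%:E : \bar R).
  by apply/measurable_EFinP; exact: measurable_funX.
have mQ2 : measurable_fun setT (fun w => ((Q w) ^+ 2)%:E : \bar R).
  by apply/measurable_EFinP; exact: measurable_funX.
have G2 : (\int[P]_w ((G w) ^+ 2)%:E < +oo)%E.
  rewrite (ae_eq_integral (fun w => ((Q w) ^+ 2)%:E))//; first exact: sq.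
  by apply: filterS GQ => w ->.
split => //; last 1 first.
- move=> F sF; have tF := smooth_cylindrical_tame (cov_comb T r) sF.
  have [mF bF dF bF'] := tF.
  rewrite unlock -(duality_poly hT hP rT tF pQ).
  have mF' := measurable_dir_deriv mF dF.
  have E w : dir_deriv F (G w *: cov_comb T r) w = G w * dir_deriv F (cov_comb T r) w.
    have d1 := tame_derivable tF w.
    rewrite {1}/dir_deriv.
    rewrite (_ : (fun e => _) =
        (fun e : R => F (w + e *: cov_comb T r)) \o (fun e => e * G w)); last first.
      by apply/funext => e /=; rewrite scalerA.
    rewrite derive1E.
    have d2 : is_derive (0 : R) 1 (fun e : R => e * G w) (G w).
      by apply: is_derive_eq; rewrite scale0r add0r; exact: mulr1.
    have d3 : is_derive ((fun e : R => e * G w) 0) 1 (fun e : R => F (w + e *: cov_comb T r))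
        (dir_deriv F (cov_comb T r) w) by rewrite mul0r.
    have [_ ->] := @is_derive1_comp _ (fun e : R => F (w + e *: cov_comb T r))
      (fun e : R => e * G w) 0 _ _ d3 d2.
    by rewrite mulrC.
  apply: ae_eq_integral => //.
  + apply/measurable_EFinP; under eq_fun do rewrite E; exact: measurable_funM.
  + by apply/measurable_EFinP; exact: measurable_funM.
  + by apply: filterS GQ => w GQ _; rewrite E GQ mulrC.
- split.
  + by move=> w; exact: cameron_martin_cov_comb.
  + by move=> s; apply: measurable_funM.
  + under eq_integral do rewrite cm_norm2_cov_comb//.
    have /andP[n0 noo] := cov_comb_norm2_lty hT r.
    rewrite ge0_integralZr//; last by move=> w _; rewrite lee_fin sqr_ge0.
    apply: lte_mul_pinfty => //; first by apply: integral_ge0 => w _; rewrite lee_fin sqr_ge0.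
    by rewrite ge0_fin_numE// integral_ge0// => w _; rewrite lee_fin sqr_ge0.
exact: sq.
Qed.

End existence.

(** * The iterated divergence *)
Section malliavin_matrix.
Context (R : realType).

(** Let v be in the kernel, so that the function u |-> sum_i v_i min(s_i, u)
    vanishes at all times. Let s_k be the largest time with v_k <> 0 and x the
    next largest one, or 0 if there is none. On [x, s_k] the function is affine
    with slope v_k, and it vanishes at both ends: v_k = 0. *)
Lemma malliavin_cov_unitmx n (s : n.-tuple R) :
  uniq s -> all (fun x => 0 < x) s -> malliavin_cov s \in unitmx.
Proof.
move=> us /allP s0; rewrite -row_free_unit; apply: inj_row_free => v vA.
have {}vA k : \sum_i v 0 i * Num.min (tnth s i) (tnth s k) = 0.
  have := congr1 (fun M : 'rV_n => M 0 k) vA; rewrite !mxE => E; rewrite -[RHS]E.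
  by apply: eq_bigr => i _; rewrite mxE.
apply/eqP/negPn/negP => /eqP v0.
have [i0 vi0] : exists i, v 0 i != 0.
  apply/existsP; apply: contra_notT v0 => /existsPn v0; apply/rowP => i.
  by rewrite mxE; apply/eqP/negPn/v0.
pose S : pred 'I_n := fun i => v 0 i != 0.
have [k Sk kmax] := @arg_maxP _ _ _ i0 S (fun i => tnth s i) vi0.
have {}kmax i : v 0 i != 0 -> tnth s i <= tnth s k by exact: kmax.
have E1 : \sum_i v 0 i * tnth s i = 0.
  rewrite -[RHS](vA k); apply: eq_bigr => i _.
  have [->|Si] := eqVneq (v 0 i) 0; first by rewrite !mul0r.
  by rewrite min_l//; exact: kmax.
have [x [xk xS Ex]] : exists x, [/\ x < tnth s k,
    forall i, i != k -> v 0 i != 0 -> tnth s i <= x &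
    \sum_i v 0 i * Num.min (tnth s i) x = 0].
  have [/existsP[i1 /andP[i1k Si1]]|/existsPn none] :=
      boolP [exists i, (i != k) && (v 0 i != 0)].
    have [k' /andP[k'k Sk'] k'max] := @arg_maxP _ _ _ i1
      (fun i => (i != k) && (v 0 i != 0)) (fun i => tnth s i)
      (introT andP (conj i1k Si1)).
    have {}k'max i : (i != k) && (v 0 i != 0) -> tnth s i <= tnth s k'.
      exact: k'max.
    exists (tnth s k'); split => //.
    - rewrite lt_neqAle kmax// andbT; apply: contra k'k => /eqP.
      by move/(tuple_uniqP _ us) => ->.
    - by move=> i ik Si; apply: k'max; rewrite ik.
  exists 0; split.
  - by apply: s0; exact: mem_tnth.
  - by move=> i ik Si; have := none i; rewrite ik Si.
  - by rewrite big1// => i _; rewrite min_r ?mulr0// ltW// s0// mem_tnth.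
have E : \sum_i (v 0 i * tnth s i - v 0 i * Num.min (tnth s i) x) = 0.
  by rewrite sumrB E1 Ex subrr.
have : v 0 k * (tnth s k - x) = 0.
  rewrite -[RHS]E (bigD1 k)//= big1 ?addr0.
    by rewrite -mulrBr min_r// ltW.
  move=> i ik; rewrite -mulrBr.
  have [->|Si] := eqVneq (v 0 i) 0; first by rewrite mul0r.
  by rewrite min_l ?subrr ?mulr0// xS.
move=> /eqP; rewrite mulf_eq0 subr_eq0 (negbTE Sk)/= => /eqP sx.
by rewrite sx ltxx in xk.
Qed.

End malliavin_matrix.

Section weights.
Context (R : realType) (T : R) (hT : 0 < T).
Local Notation cpath := (cpath T).
Variables (P : probability cpath R) (hP : is_wiener P).

Lemma is_divergence_divergence Z D : is_divergence P Z D ->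
  is_divergence P Z (divergence P Z).
Proof. by move=> H; apply: (@xgetPex _ _ [set D | is_divergence P Z D]); exists D. Qed.

Section times.
Variables (n : nat) (s : n.-tuple R).
Hypotheses (us : uniq s) (s0 : all (fun x => 0 < x) s) (sT : all (fun x => x <= T) s).

Definition dual_seq (j : 'I_n) : seq (R * R) :=
  [seq (invmx (malliavin_cov s) i j, tnth s i) | i <- index_enum 'I_n].

Lemma dual_pathE j : dual_path T s j = cov_comb T (dual_seq j).
Proof. by rewrite /cov_comb big_map. Qed.

Lemma tnth_bounds i : 0 <= tnth s i <= T.
Proof. by rewrite (ltW (allP s0 _ (mem_tnth i s)))/= (allP sT _ (mem_tnth i s)). Qed.

Lemma dual_seq_bounds j : all (fun p => 0 <= p.2 <= T) (dual_seq j).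
Proof. by apply/allP => p /mapP[i _ ->]; exact: tnth_bounds. Qed.

(** An entry of the product of the covariance matrix and its inverse. *)
Lemma dual_path_ev j k : cov_comb T (dual_seq j) (tnth s k) = (k == j)%:R :> R.
Proof.
rewrite -dual_pathE /dual_path cpath_sum.
have := mulmxV (malliavin_cov_unitmx us s0).
move=> /(congr1 (fun M : 'M[R]_n => M k j)); rewrite !mxE => <-.
apply: eq_bigr => i _; rewrite cpathZ cov_pathE ?tnth_bounds// mxE.
by rewrite mulrC minC.
Qed.

Definition weight_poly (l : seq 'I_n) : cpath -> R :=
  foldl (fun Q j => poly_div (dual_seq j) Q) (fun=> 1) l.

(** At each step [is_divergence_poly_div] provides a version of the divergence,
    and uniqueness identifies it with the one that was chosen. *)
Lemma iter_divergence_poly l :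
  let G := foldl (fun G j => divergence P (fun w => G w *: dual_path T s j))
        (fun=> 1) l in
  [/\ measurable_fun setT G, ({ae P, forall w, G w = weight_poly l w}) &
      cyl_poly (weight_poly l)].
Proof.
elim/last_ind: l => [/=|l j /= [mG GQ pQ]].
  by split => //; [exact: aeW|exact: cyl_poly_cst].
rewrite /weight_poly !foldl_rcons -/(weight_poly l).
move: mG GQ; set G := foldl _ _ _ => mG GQ.
have D := is_divergence_poly_div hT hP (dual_seq_bounds j) mG GQ pQ.
rewrite -dual_pathE in D.
have D' := is_divergence_divergence D.
split; [by case: D'|exact: (divergence_unique hT D' D)|exact: cyl_poly_div].
Qed.

Variables (b : R -> R) (hb : C1b b).

(** Interpolates between the product of the derivatives (l empty) and the product
    of the undifferentiated factors (l full). *)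
Definition mixed_prod (l : seq 'I_n) (w : cpath) : R :=
  \prod_(i < n) (if i \in l then b else derive1 b) (w (tnth s i)).

Lemma C1b_measurable : measurable_fun setT b /\ measurable_fun setT (derive1 b).
Proof.
have [db cb _ _] := hb; split; apply: continuous_measurable_fun => //.
by move=> x; apply: differentiable_continuous; apply/derivable1_diffP.
Qed.

Lemma mixed_prod_regular (I : pred 'I_n) (l : seq 'I_n) :
  let F := fun w : cpath => \prod_(i < n | I i)
    (if i \in l then b else derive1 b) (w (tnth s i)) in
  measurable_fun setT F /\ exp_bounded F.
Proof.
have [mb mb'] := C1b_measurable.
have [_ _ [M bM] [M' bM']] := hb.
rewrite /=; elim: (index_enum _) => [|i r [mF bF]].
  under eq_fun do rewrite big_nil.
  by split; [exact: measurable_cst|exact: exp_bounded_cst].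
have [Ii|nIi] := boolP (I i); last first.
  by under eq_fun do rewrite big_cons (negbTE nIi).
under eq_fun do rewrite big_cons Ii.
split.
  apply: measurable_funM => //; case: ifP => _.
    exact: (measurableT_comp mb (measurable_ev _)).
  exact: (measurableT_comp mb' (measurable_ev _)).
apply: exp_boundedM => //; case: ifP => _.
  exact: (@exp_bounded_bounded _ _ _ M).
exact: (@exp_bounded_bounded _ _ _ M').
Qed.

(** By [dual_path_ev] a move along h_j changes the factor of index j only. *)
Lemma tame_mixed_prod l j : j \notin l ->
  tame (cov_comb T (dual_seq j)) (mixed_prod (rcons l j)) /\
  dir_deriv (mixed_prod (rcons l j)) (cov_comb T (dual_seq j)) = mixed_prod l.
Proof.
move=> jl.
have [m1 b1] := mixed_prod_regular xpredT (rcons l j).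
have [m2 b2] := mixed_prod_regular xpredT l.
apply: tame_intro => // w.
set h := cov_comb _ _.
pose C := \prod_(i < n | i != j) (if i \in l then b else derive1 b) (w (tnth s i)).
have -> : (fun e : R => mixed_prod (rcons l j) (w + e *: h)) =
    (fun e : R => b (e + w (tnth s j)) * C).
  apply/funext => e; rewrite /mixed_prod (bigD1 j)//= mem_rcons mem_head.
  congr (_ * _).
    congr b; rewrite -[LHS]/(w (tnth s j) + e * h (tnth s j)).
    by rewrite dual_path_ev eqxx mulr1 addrC.
  apply: eq_bigr => i ij; rewrite mem_rcons inE (negbTE ij)/=.
  apply: congr1; rewrite -[LHS]/(w (tnth s i) + e * h (tnth s i)).
  by rewrite dual_path_ev (negbTE ij) mulr0 addr0.
have -> : mixed_prod l w = derive1 b (w (tnth s j)) * C.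
  by rewrite /mixed_prod (bigD1 j)//= (negbTE jl).
have [db _ _ _] := hb.
have d0 : is_derive (0 + w (tnth s j)) 1 b (derive1 b (w (tnth s j))).
  by rewrite add0r; split; [exact: db|rewrite derive1E].
have d1 : is_derive (0 : R) 1 (fun e : R => e + w (tnth s j)) 1.
  by apply: is_derive_eq; rewrite addr0.
have d2 := @is_derive1_comp _ b (fun e : R => e + w (tnth s j)) 0 _ _ d0 d1.
rewrite mulr1 in d2.
have := @is_deriveM _ _ (b \o (fun e : R => e + w (tnth s j))) (cst C) 0 1 _ _ d2 _.
move=> /(_ 0 (is_derive_cst _ _ _)) H.
apply: is_derive_eq H _; rewrite scaler0 add0r mulrC //.
Qed.

(** The last index j of l is removed by duality: the divergence along h_j leaves
    the weight and differentiates the factor of index j, which is what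
    [mixed_prod] does when j leaves l. *)
Lemma integral_weight_poly l : uniq l ->
  (\int[P]_w (mixed_prod l w * weight_poly l w)%:E =
   \int[P]_w (mixed_prod [::] w)%:E)%E.
Proof.
elim/last_ind: l => [_|l j IH].
  by apply: eq_integral => w _; rewrite mulr1.
rewrite rcons_uniq => /andP[jl ul]; rewrite -(IH ul).
have [tF dF] := tame_mixed_prod jl.
have [_ _ pQ] := iter_divergence_poly l.
rewrite /weight_poly foldl_rcons -/(weight_poly l).
by rewrite -(duality_poly hT hP (dual_seq_bounds j) tF pQ) dF.
Qed.

Lemma expectation_weight :
  ('E_P[fun w => (\prod_(i < n) b (w (tnth s i)) * Lambda P s w)%R] =
   'E_P[fun w => (\prod_(i < n) derive1 b (w (tnth s i)))%R])%E.
Proof.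
have [mL Lae pQ] := iter_divergence_poly (enum 'I_n).
rewrite unlock /Lambda us s0/= /iter_divergence.
have pE (w : cpath) : \prod_(i < n) b (w (tnth s i)) = mixed_prod (enum 'I_n) w.
  by apply: eq_bigr => i _; rewrite mem_enum.
have [mF _] := mixed_prod_regular xpredT (enum 'I_n).
have mQ : measurable_fun setT (weight_poly (enum 'I_n)).
  by have [[]] := cyl_poly_tame 0 pQ.
under eq_integral do rewrite pE.
rewrite (ae_eq_integral
  (fun w => (mixed_prod (enum 'I_n) w * weight_poly (enum 'I_n) w)%:E))//.
- by rewrite integral_weight_poly ?enum_uniq//; apply: eq_integral => w _.
- by apply/measurable_EFinP; exact: measurable_funM.
- by apply/measurable_EFinP; exact: measurable_funM.
- by apply: filterS Lae => w ->.
Qed.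

End times.
End weights.

(** * The moment of the time integral *)
Section tensor.
Context (R : realType).
Let Rm : measurableType _ := measurableTypeR R.
Notation leb := (@lebesgue_measure R).

Lemma measurable_tensor n (phi : Rm -> R) : measurable_fun setT phi ->
  measurable_fun setT (fun s : n.-tuple Rm => \prod_(i < n) phi (tnth s i)).
Proof.
move=> mphi; apply: measurable_prod => i _.
exact: (measurableT_comp mphi (measurable_tnth i)).
Qed.

Lemma tensor_tcons n (phi : Rm -> R) x (y : n.-tuple Rm) :
  \prod_(i < n.+1) phi (tnth (tcons (x, y)) i) =
  phi x * \prod_(i < n) phi (tnth y i).
Proof.
rewrite big_ord_recl; congr (_ * _).
by apply: eq_bigr => i _; rewrite /tcons tnthS.
Qed.

Lemma integral_tensor n (phi : Rm -> R) : leb.-integrable setT (EFin \o phi) ->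
  (lebesgue_tuple R n).-integrable setT
    (fun s => (\prod_(i < n) phi (tnth s i))%:E) /\
  (\int[lebesgue_tuple R n]_s (\prod_(i < n) phi (tnth s i))%:E =
   ((\int[leb]_x phi x) ^+ n)%:E)%E.
Proof.
move=> iphi; have mphi : measurable_fun setT phi.
  by apply/measurable_EFinP; exact: measurable_int iphi.
have mt k : measurable_fun setT
    (fun s : k.-tuple Rm => (\prod_(i < k) phi (tnth s i))%:E : \bar R).
  by apply/measurable_EFinP; exact: measurable_tensor.
have Iphi : (\int[leb]_x (phi x)%:E = (\int[leb]_x phi x)%R%:E)%E.
  by rewrite /Rintegral fineK//; exact: integrable_fin_num iphi.
elim: n => [|n [IHi IHe]].
  split.
    apply/integrableP; split; first exact: mt.
    rewrite /= integral_dirac//; last first.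
      apply/measurable_EFinP; apply: measurableT_comp => //.
      exact: (@measurable_tensor 0 phi mphi).
    by rewrite diracE in_setT mul1e big_ord0 /= ltry.
  rewrite /= integral_dirac//; last exact: mt.
  by rewrite diracE in_setT mul1e big_ord0 expr0.
have mtc : measurable_fun setT ((fun s : n.+1.-tuple Rm =>
    (\prod_(i < n.+1) phi (tnth s i))%:E : \bar R) \o @tcons R n).
  by apply: (measurableT_comp (mt n.+1)); exact: measurable_tcons.
have itc : (leb \x lebesgue_tuple R n)%E.-integrable setT ((fun s : n.+1.-tuple Rm =>
    (\prod_(i < n.+1) phi (tnth s i))%:E : \bar R) \o @tcons R n).
  apply/integrable12ltyP => //.
  have /integrableP[_ aphi] := iphi; have /integrableP[_ aprod] := IHi.
  rewrite (eq_integral (fun x => (`|(phi x)%:E| *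
    \int[lebesgue_tuple R n]_s `|(\prod_(i < n) phi (tnth s i))%:E|))%E); last first.
    move=> x _; rewrite -ge0_integralZl//; last by apply: measurableT_comp => //; exact: mt.
    by apply: eq_integral => y _; rewrite /= tensor_tcons normrM EFinM.
  rewrite ge0_integralZr//; last 2 first.
  - by apply: measurableT_comp => //; exact/measurable_EFinP.
  - exact: integral_ge0.
  by apply: lte_mul_pinfty => //; [exact: integral_ge0|rewrite ge0_fin_numE//; exact: integral_ge0].
split.
  exact: (integrable_pushforward (@measurable_tcons R n) (mt n.+1) itc measurableT).
rewrite [LHS](integral_pushforward (@measurable_tcons R n) (mt n.+1) itc measurableT).
rewrite preimage_setT -integral12_prod_meas1//.
transitivity (\int[leb]_x ((phi x)%:E * ((\int[leb]_x phi x) ^+ n)%:E))%E.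
  apply: eq_integral => x _; rewrite /fubini_F -IHe -integralZl//.
  by apply: eq_integral => y _; rewrite /= tensor_tcons EFinM.
by rewrite integralZr// Iphi -EFinM exprS.
Qed.

(** Putting 0 in front excludes repeated times and the time 0 by one condition. *)
Definition bad_times n : set (n.-tuple Rm) := [set s | ~~ uniq (0 :: s)].

Lemma measurable_bad_times n : measurable (@bad_times n).
Proof.
have mE (f : n.-tuple Rm -> R) : measurable_fun setT f -> measurable [set s | f s = 0].
  by move=> mf; rewrite -[X in measurable X]setTI; exact: (mf measurableT [set 0]).
rewrite (_ : @bad_times n =
   (\bigcup_(i in [set: 'I_n]) [set s : n.-tuple Rm | tnth s i = 0]) `|`
   (\bigcup_(ij in [set ij : 'I_n * 'I_n | ij.1 != ij.2])
      [set s : n.-tuple Rm | tnth s ij.1 - tnth s ij.2 = 0])).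
  apply: measurableU; apply: fin_bigcup_measurable => // i _; apply: mE.
    exact: measurable_tnth.
  by apply: measurable_funB; exact: measurable_tnth.
apply/seteqP; split => s; rewrite /bad_times /=.
  rewrite negb_and negbK => /orP[/tnthP[i /esym si]|us]; first by left; exists i.
  right; apply: contrapT => H; move/negP : us; apply; apply/tuple_uniqP => i j sij.
  apply/eqP; apply: contrapT => /negP ij; apply: H; exists (i, j) => //=.
  by rewrite sij subrr.
move=> [[i _ /= si]|[[i j] /= ij sij]]; rewrite negb_and negbK.
  by apply/orP; left; apply/tnthP; exists i.
apply/orP; right; apply/negP => /tuple_uniqP us; move/negP : ij; apply.
by apply/eqP/us/eqP; rewrite -subr_eq0 sij.
Qed.

(** If the later times are good, a bad first time is 0 or one of them. *)
Lemma bad_times_null n : lebesgue_tuple R n (@bad_times n) = 0%E.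
Proof.
elim: n => [|n IH].
  rewrite /= diracE (_ : _ \in _ = false)//; apply/negbTE.
  by rewrite notin_setE /bad_times /=.
have mB := @measurable_bad_times n.+1.
have mtB : measurable (@tcons R n @^-1` (@bad_times n.+1)).
  by rewrite -[X in measurable X]setTI; exact: measurable_tcons.
rewrite /= /lebesgue_cons /pushforward.
rewrite (product_measure_unique (m' := leb \x^ lebesgue_tuple R n)%E)//; last first.
  by move=> A B *; rewrite /= product_measure2E.
transitivity (\int[lebesgue_tuple R n]_y
    (leb \o ysection (@tcons R n @^-1` @bad_times n.+1)) y)%E; first by [].
rewrite (ae_eq_integral (cst 0%E)) ?integral0//.
- exact: measurable_fun_ysection.
- exists (@bad_times n); split => //; first exact: measurable_bad_times.
  move=> y /=; apply: contra_notP; rewrite /bad_times /= => /negP; rewrite negbK.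
  move=> /andP[y0 uy] _; rewrite (_ : ysection _ _ = [set` 0 :: y]).
    apply: countable_lebesgue_measure0; apply: finite_set_countable.
    exact: finite_seq.
  apply/seteqP; split => x; rewrite /ysection /= inE /bad_times /tcons /=.
    apply: contraNT; rewrite !inE !negb_or => /andP[x0 xy].
    by rewrite (eq_sym 0) x0 y0 xy uy.
  by rewrite !inE => /orP[/eqP ->|xy]; rewrite ?eqxx// xy andbF.
Qed.

End tensor.

Section main.
Context (R : realType) (T : R) (hT : 0 < T).
Let Rm : measurableType _ := measurableTypeR R.
Local Notation cpath := (cpath T).
Variables (P : probability cpath R) (hP : is_wiener P).
Notation leb := (@lebesgue_measure R).

Section moment.
Variables (f : R -> R) (mf : measurable_fun setT f) (M : R)
  (fM : forall x, `|f x| <= M) (t : R).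

(** With the indicator as a factor of the integrand, the integral over [0, t]^n is
    an integral of a product over the whole of R^n. *)
Definition truncated (w : cpath) (s : Rm) : R := \1_`[0, t] s * f (w s).

Lemma measurable_truncated : measurable_fun setT
  (fun x : Rm * cpath => truncated x.2 x.1).
Proof.
apply: measurable_funM.
  exact: (measurableT_comp (measurable_indic (measurable_itv `[0, t])) measurable_fst).
exact: (measurableT_comp mf (@measurable_path_eval R T)).
Qed.

Definition cube n : set (n.-tuple Rm) := [set s | forall i, 0 <= tnth s i <= t].

Lemma prod_truncated n (w : cpath) (s : n.-tuple Rm) :
  \prod_(i < n) truncated w (tnth s i) =
  \1_(@cube n) s * \prod_(i < n) f (w (tnth s i)).
Proof.
rewrite big_split /=; congr (_ * _); rewrite indicE.
have [sc|/existsNP[i si]] := pselect (@cube n s).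
  rewrite mem_set// big1// => i _; rewrite indicE mem_set//=.
  by rewrite in_itv/=; exact: sc.
rewrite memNset//.
rewrite (bigD1 i)//= indicE memNset ?mul0r//=.
Qed.

Lemma integrable_scaled_indic c : leb.-integrable setT (EFin \o (fun s : Rm => c * \1_`[0, t] s)).
Proof.
have i1 := @integrable_indic_itv R 0 t true false.
apply: (eq_integrable measurableT _ _ _ (integrableZl measurableT c i1)).
by move=> s _; rewrite /= EFinM.
Qed.

Lemma integrable_truncated (w : cpath) : leb.-integrable setT (EFin \o truncated w).
Proof.
have M0 : 0 <= M := le_trans (normr_ge0 _) (fM 0).
apply: (le_integrable measurableT _ _ (integrable_scaled_indic M)).
  by apply/measurable_EFinP; exact: (measurable_fun_pair1 w measurable_truncated).
move=> s _; rewrite /= lee_fin /truncated normrM mulrC normrM ler_wpM2r//.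
by rewrite (ger0_norm M0).
Qed.

Lemma Rintegral_truncated (w : cpath) :
  \int[leb]_(s in `[0, t]) f (w s) = \int[leb]_s truncated w s.
Proof.
rewrite Rintegral_mkcond; apply: eq_Rintegral => s _.
by rewrite patchE /truncated indicE; case: ifP; rewrite ?mul1r ?mul0r.
Qed.

Definition prod_truncated_pair n (x : cpath * n.-tuple Rm) : \bar R :=
  (\prod_(i < n) truncated x.1 (tnth x.2 i))%:E.

Lemma integrable_prod_truncated n :
  (P \x lebesgue_tuple R n)%E.-integrable setT (@prod_truncated_pair n).
Proof.
pose F := @prod_truncated_pair n.
have mF : measurable_fun setT F.
  apply/measurable_EFinP; apply: measurable_prod => i _.
  have mp : measurable_fun setT
      (fun x : cpath * n.-tuple Rm => (tnth x.2 i, x.1) : Rm * cpath).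
    apply: measurable_fun_pair; last exact: measurable_fst.
    exact: (measurableT_comp (measurable_tnth i) measurable_snd).
  exact: (measurableT_comp measurable_truncated mp).
apply/integrable12ltyP => //.
pose C := (\int[leb]_x (M * \1_`[0, t] x)) ^+ n.
apply: (@le_lt_trans _ _ (\int[P]_w (cst C%:E w))%E); last first.
  by rewrite integral_cst//= probability_setT mule1 ltry.
have M0 : 0 <= M := le_trans (normr_ge0 _) (fM 0).
have [iM EM] := integral_tensor n (integrable_scaled_indic M).
have mabs : measurable_fun setT (fun x => `|F x|)%E by exact: measurableT_comp.
apply: ge0_le_integral => //.
- by move=> w _; exact: integral_ge0.
- exact: (measurable_fun_fubini_tonelli_F (fun x => `|F x|)%E).
- move=> w _; rewrite /cst /C -EM; apply: ge0_le_integral => //.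
  + exact: (measurable_fun_pair2 _ mabs).
  + exact: measurable_int iM.
  + move=> s _; rewrite lee_fin normr_prod; apply: ler_prod => i _.
    by rewrite normr_ge0/= /truncated normrM mulrC [X in _ * X <= _]ger0_norm// ler_wpM2r.
Qed.

(** The n-th power of an integral is the integral of the tensor power
    ([integral_tensor]). *)
Lemma moment_fubini n :
  ('E_P[fun w => ((\int[leb]_(s in `[0, t]) f (w s)) ^+ n)%R] =
   \int[lebesgue_tuple R n]_s 'E_P[fun w => (\prod_(i < n) truncated w (tnth s i))%R])%E.
Proof.
rewrite unlock.
transitivity (\int[P]_w \int[lebesgue_tuple R n]_s
    (\prod_(i < n) truncated w (tnth s i))%:E)%E.
  apply: eq_integral => w _.
  by rewrite (integral_tensor n (integrable_truncated w)).2 Rintegral_truncated.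
exact: (Fubini (integrable_prod_truncated n)).
Qed.

Lemma measurable_expectation_truncated n : measurable_fun setT
  (fun s : n.-tuple Rm => 'E_P[fun w => (\prod_(i < n) truncated w (tnth s i))%R])%E.
Proof. by rewrite unlock; exact: (measurable_fubini_G (integrable_prod_truncated n)). Qed.

End moment.
End main.

Theorem proposition2p2 (R : realType) (T : R) (hT : 0 < T)
    (P : probability (cpath T) R) (hP : is_wiener P)
    (b : R -> R) (hb : C1b b) (n : nat) (hn : (1 <= n)%N)
    (t : R) (ht0 : 0 < t) (htT : t <= T) :
  ('E_P[fun w => ((\int[lebesgue_measure]_(s in `[0, t]) derive1 b (w s)) ^+ n)%R]
   = \int[lebesgue_tuple R n]_(s in [set s | forall i, (0 <= tnth s i <= t)%R])
       'E_P[fun w => (\prod_(i < n) b (w (tnth s i)) * Lambda P s w)%R])%E.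
Proof.
have [_ mb'] := C1b_measurable hb.
have [_ _ _ [M bM]] := hb.
rewrite (moment_fubini P mb' bM).
have mG := @measurable_expectation_truncated R T P _ mb' M bM t n.
have mN := measurableC (@measurable_bad_times R n).
rewrite (ae_eq_integral ((fun s => 'E_P[fun w =>
    (\prod_(i < n) truncated (derive1 b) t w (tnth s i))%R]) \_ (~` @bad_times R n))%E)//;
  last 2 first.
- by apply: (measurable_restrictT _ mN).1; exact: measurable_funTS mG.
- exists (@bad_times R n); split; [exact: measurable_bad_times|exact: bad_times_null|].
  move=> s /=; apply: contra_notP => sN _; rewrite patchE mem_set//.
rewrite [RHS]integral_mkcond; apply: eq_integral => s _.
rewrite !patchE.
rewrite -[X in _ = if s \in X then _ else _]/(@cube R t n).
have [sc|sc] := boolP (s \in @cube R t n); last first.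
  case: ifP => // _; rewrite unlock integral0_eq// => w _.
  by rewrite prod_truncated indicE (negbTE sc) mul0r.
have {}sc := set_mem sc.
have [sg|sb] := boolP (s \in ~` @bad_times R n).
  have {sg} : uniq (0 :: s).
    by have := set_mem sg; rewrite /bad_times /= => /negP; rewrite negbK.
  move=> /= /andP[s0 us].
  have sP : all (fun x => 0 < x) s.
    apply/allP => x xs; have /tnthP[i xi] := xs; have /andP[x0 _] := sc i.
    rewrite lt_neqAle xi x0 andbT; apply: contraNneq s0 => ->.
    exact: mem_tnth.
  have sT : all (fun x => x <= T) s.
    apply/allP => x /tnthP[i ->]; have /andP[_ xt] := sc i; exact: le_trans htT.
  rewrite (expectation_weight hT hP us sP sT hb) unlock.
  apply: eq_integral => w _.
  by rewrite prod_truncated indicE mem_set// mul1r.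
have sE : uniq s && all (fun x => 0 < x) s = false.
  apply/negbTE/negP => /andP[us /allP sP]; move/negP : sb; apply.
  rewrite inE /bad_times /=; apply/negP; rewrite negbK us andbT.
  by apply/negP => /sP; rewrite ltxx.
rewrite unlock integral0_eq// => w _.
by rewrite /Lambda sE mulr0.
Qed.
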